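(* Let $d\ge1$ and let $\Sigma$ be a $d$-dimensional simplicial sphere (a simplicial complex homeomorphic to the $d$-sphere) with $n$ facets. Then $K_{d-1}(\Sigma)\cong\mathbb{Z}/n\mathbb{Z}$.
   Context: For a finite simplicial complex $\Delta$, $C_i(\Delta;\mathbb{Z})$ is the free abelian group on the $i$-dimensional faces (each with a fixed orientation), $\partial_i:C_i\to C_{i-1}$ is the simplicial boundary map, and $\partial^*_i$ is its transpose with respect to the standard bases. The $i$-dimensional critical group is $K_i(\Delta)=\ker\partial_i/\operatorname{im}(\partial_{i+1}\partial^*_{i+1})$. Facets are the $d$-dimensional faces. *)

(* Defs.v *)
From Stdlib Require Import Reals.
From HB Require Import structures.
From mathcomp Require Import all_boot all_order all_algebra.

Set Implicit Arguments.
Unset Strict Implicit.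
Unset Printing Implicit Defensive.

Import GRing.Theory Num.Theory.
Local Open Scope ring_scope.

(* Faces are finite subsets of 'I_m; the empty face is included (it is the
   unique face of dimension -1, giving the augmented/reduced chain complex).
   A face of dimension i has cardinality i+1. *)
Definition simplicial_complex (m : nat) (D : {set {set 'I_m}}) : Prop :=
  set0 \in D /\ (forall s t : {set 'I_m}, s \in D -> t \subset s -> t \in D).

Definition chain (m : nat) := {ffun {set 'I_m} -> int}.

(* Orientation of each face fixed by the order of 'I_m: removing the vertex v
   from s gets sign (-1)^(number of vertices of s smaller than v). *)
Definition bsign (m : nat) (v : 'I_m) (s : {set 'I_m}) : int :=
  (-1) ^+ #|[set u in s | (val u < val v)%N]|.

Definition bd_coef (m : nat) (D : {set {set 'I_m}}) (k : nat)
    (t s : {set 'I_m}) : int :=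
  if (s \in D) && (#|s| == k) then
    \sum_(v in s) (if t == s :\ v then bsign v s else 0)
  else 0.

(* boundary map  partial_{k-1} : C_{k-1} -> C_{k-2}  (k = cardinality) *)
Definition bd (m : nat) (D : {set {set 'I_m}}) (k : nat) (c : chain m)
  : chain m := [ffun t => \sum_s bd_coef D k t s * c s].

Definition bdT (m : nat) (D : {set {set 'I_m}}) (k : nat) (c : chain m)
  : chain m := [ffun s => \sum_t bd_coef D k t s * c t].

Definition chains (m : nat) (D : {set {set 'I_m}}) (k : nat) (c : chain m)
  : Prop := forall s, c s != 0 -> (s \in D) && (#|s| == k).

Definition crit_ker (m : nat) (D : {set {set 'I_m}}) (k : nat) (c : chain m)
  : Prop := chains D k c /\ bd D k c = 0.

Definition crit_im (m : nat) (D : {set {set 'I_m}}) (k : nat) (c : chain m)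
  : Prop := exists b, chains D k b /\ c = bd D k.+1 (bdT D k.+1 b).

(* G/H is isomorphic to Z/nZ : H is contained in G and there is a group
   homomorphism G -> Z/nZ (given by f mod n) which is surjective with kernel H.
   (First isomorphism theorem form of  G/H ~= Z/nZ.) *)
Definition quot_iso_Zmod (m : nat) (G H : chain m -> Prop) (n : nat) : Prop :=
  (forall a, H a -> G a) /\
  exists f : chain m -> int,
    [/\ (forall a b, G a -> G b -> (f (a + b) = f a + f b %[mod n])%Z),
        (forall z : int, exists2 a, G a & (f a = z %[mod n])%Z) &
        (forall a, G a -> (H a <-> (f a = 0 %[mod n])%Z))].

(* K_i(D) = ker partial_i / im(partial_{i+1} partial_{i+1}^T) is isomorphic to
   Z/nZ;  faces of dimension i have cardinality i+1. *)
Definition critical_group_iso_Zmod (m : nat) (D : {set {set 'I_m}})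
    (i : nat) (n : nat) : Prop :=
  quot_iso_Zmod (crit_ker D i.+1) (crit_im D i.+1) n.

Definition num_faces (m : nat) (D : {set {set 'I_m}}) (d : nat) : nat :=
  #|[set s in D | #|s| == d.+1]|.

Definition rsum (n : nat) (x : 'I_n -> R) : R := \big[Rplus/R0]_(i < n) x i.

Definition rdist (n : nat) (x y : 'I_n -> R) : R :=
  \big[Rmax/R0]_(i < n) Rabs (Rminus (x i) (y i)).

Definition realization (m : nat) (D : {set {set 'I_m}}) (x : 'I_m -> R)
  : Prop :=
  (forall i, Rle R0 (x i)) /\ rsum x = R1 /\
  exists2 s, s \in D & (forall i, i \in s <-> Rlt R0 (x i)).

Definition sphere (d : nat) (y : 'I_d.+1 -> R) : Prop :=
  rsum (fun i => Rmult (y i) (y i)) = R1.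

Definition continuous_on (p q : nat) (A : ('I_p -> R) -> Prop)
    (f : ('I_p -> R) -> ('I_q -> R)) : Prop :=
  forall x, A x -> forall eps, Rlt R0 eps -> exists2 delta, Rlt R0 delta &
    forall x', A x' -> Rlt (rdist x x') delta -> Rlt (rdist (f x) (f x')) eps.

Definition homeomorphic (p q : nat) (A : ('I_p -> R) -> Prop)
    (B : ('I_q -> R) -> Prop) : Prop :=
  exists (f : ('I_p -> R) -> ('I_q -> R)) (g : ('I_q -> R) -> ('I_p -> R)),
    [/\ forall x, A x -> B (f x),
        forall y, B y -> A (g y),
        forall x, A x -> g (f x) = x,
        forall y, B y -> f (g y) = y &
        continuous_on A f /\ continuous_on B g].

Definition simplicial_sphere (m : nat) (D : {set {set 'I_m}}) (d : nat) : Prop :=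
  simplicial_complex D /\ homeomorphic (realization D) (@sphere d).

(* Main.v *)
Require Import Defs.
From Stdlib Require Import Reals Lra.
From HB Require Import structures.
From mathcomp Require Import all_boot all_order all_algebra.
From Coquelicot Require Import Rcomplements.
From mathcomp.classical Require Import boolp.
From mathcomp.multinomials Require Import freeg.

(** The topological input is obtained from chains of small tuples of points.
For a set X in R^q, consider the free abelian group on the k-tuples of points of X
of diameter < e. Star-shaped sets have no such homology. A simplicial chain of a
complex K is subdivided into small tuples of |K| by filling simplices inductively,
and, once e < 1/m, a small tuple (x_1, ..., x_k) is sent back to the oriented simplex
phi(x_1) /\ ... /\ phi(x_k), where phi(x) is a vertex at which x is at least 1/m; going
forth and back is the identity. Hence if |K| is a continuous retract of a compact set X
without small homology, then K is acyclic.

For a top-dimensional face s of the sphere D, the stereographic projection from the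
barycenter of s makes |D \ s| a retract of a convex set, so D \ s is acyclic. Comparing D
with the boundary of a simplex shows that D has no homology outside degree d, so dim D = d.
It follows that the d-cycles are generated by some z with all coefficients 1 or -1,
and a contracting homotopy h of D \ s gives, by transposition, that the image of the
transposed boundary is the orthogonal complement of z. The isomorphism with Z/n is then
c |-> <z, h c> modulo n = <z, z>. *)

Set Implicit Arguments.
Unset Strict Implicit.
Unset Printing Implicit Defensive.

Import GRing.Theory Num.Theory.
Local Open Scope ring_scope.

(** * Chains of tuples *)

(** Tuples replace singular simplices because any map acts on them point by point, and no simplex
    has to lie in the space. Without a bound on the diameter every cycle of a nonempty set would
    bound by coning, so smallness carries all the topology. The price is that maps and fillings
    change scales, whence uniform continuity and the compactness of the spaces involved. The
    comparison only needs G o F to be the identity of |K|, never F o G, so no homotopy invariance in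
    X is required. The bound 1/m is the average of m coordinates of sum 1: some coordinate reaches
    it, and such a coordinate stays positive under any displacement smaller than 1/m. On the
    algebraic side the obstacle is integrality: over the rationals the image of the transposed
    boundary would be the orthogonal complement of z by a dimension count, while over the integers
    this comes from the contraction h, which exists because all of the homology of D \ s vanishes,
    torsion included. *)

(** Recursion on a rank with a specification in place of a formula: the value at [b] only has to
    satisfy [Q], which may refer to values of lower rank. The contraction, the subdivision and the
    chain homotopy below are all built this way. *)
Lemma rank_choice (B W : Type) (rank : B -> nat) (Q : (B -> W) -> B -> W -> Prop)
    (w0 : W) :
  (forall h h' b w, (forall b', (rank b' < rank b)%N -> h b' = h' b') ->
     Q h b w -> Q h' b w) ->
  (forall h b, (forall b', (rank b' < rank b)%N -> Q h b' (h b')) ->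
     exists w, Q h b w) ->
  exists h, forall b, Q h b (h b).
Proof.
move=> Qext Qex.
have /choice[F FP] (hb : (B -> W) * B) : exists w,
    (forall b', (rank b' < rank hb.2)%N -> Q hb.1 b' (hb.1 b')) -> Q hb.1 hb.2 w.
  case: hb => h b /=.
  have [hQ|hQ] := pselect (forall b', (rank b' < rank b)%N -> Q h b' (h b')).
    by have [w wP] := Qex h b hQ; exists w.
  by exists w0.
(* Values of [H n] are final in rank below [n]; the others are provisional and hidden from [Q] by
   the first hypothesis. *)
pose fix H n : B -> W := if n is n'.+1 then
  fun b => if (rank b < n')%N then H n' b else F (H n', b) else fun=> w0.
pose h b := H (rank b).+1 b.
have HE n b : (rank b < n)%N -> H n b = h b.
  elim: n => // n IHn; rewrite ltnS leq_eqVlt => /orP[/eqP rb|rb].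
    by rewrite /h -rb.
  by rewrite /= rb IHn.
exists h => b; have [n] := ubnP (rank b); elim: n b => // n IHn b; rewrite ltnS => rb.
apply: (@Qext (H (rank b))) => [b' rb'|]; first by rewrite HE.
rewrite /h /= ltnn; apply: (FP (H (rank b), b)) => /= b' rb'.
rewrite HE //; apply: (@Qext h) => [b'' rb''|]; last exact: IHn (leq_trans rb' rb).
by rewrite HE //; apply: ltn_trans rb'.
Qed.

(* The empty tuple is a basis element of degree -1: the complex is augmented, and
   tuples of size [k] play the role of [(k-1)]-simplices. *)
Definition tchain (T : choiceType) := {freeg seq T}.

Section TupleChains.
Variable T : choiceType.
Implicit Types (s : seq T) (c : tchain T).

(** The subgroup generated by [S], presented by adding or subtracting one generator at a time, so
    that support bounds never inspect coefficients. With [spannedT] it is also the induction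
    principle for identities between additive maps. *)
Inductive spanned (S : seq T -> Prop) : tchain T -> Prop :=
| spanned0 : spanned S 0
| spannedD c s : spanned S c -> S s -> spanned S (c + << s >>)
| spannedB c s : spanned S c -> S s -> spanned S (c - << s >>).

Lemma spanned_sub (S S' : seq T -> Prop) c :
  (forall s, S s -> S' s) -> spanned S c -> spanned S' c.
Proof.
move=> SS'; elim=> [|d s _ IH Ss|d s _ IH Ss]; first exact: spanned0.
  by apply: spannedD => //; apply: SS'.
by apply: spannedB => //; apply: SS'.
Qed.

Lemma spannedU (S : seq T -> Prop) s : S s -> spanned S << s >>.
Proof. by move=> Ss; rewrite -[<<s>>]add0r; apply: spannedD => //; apply: spanned0. Qed.

Lemma spanned_add (S : seq T -> Prop) c c' :
  spanned S c -> spanned S c' -> spanned S (c + c').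
Proof.
move=> Sc; elim=> [|d s _ IH Ss|d s _ IH Ss]; first by rewrite addr0.
  by rewrite addrA; apply: spannedD.
by rewrite addrA; apply: spannedB.
Qed.

Lemma spanned_opp (S : seq T -> Prop) c : spanned S c -> spanned S (- c).
Proof.
elim=> [|d s _ IH Ss|d s _ IH Ss]; first by rewrite oppr0; apply: spanned0.
  by rewrite opprD; apply: spannedB.
by rewrite opprB addrC; apply: spannedD.
Qed.

Lemma spanned_sum (I : Type) (r : seq I) (P : pred I) (S : seq T -> Prop)
    (F : I -> tchain T) :
  (forall i, P i -> spanned S (F i)) -> spanned S (\sum_(i <- r | P i) F i).
Proof.
by move=> SF; apply: big_ind => //; [apply: spanned0 | apply: spanned_add].
Qed.

Lemma spanned_mulz (S : seq T -> Prop) c (k : int) :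
  spanned S c -> spanned S (c *~ k).
Proof.
move=> Sc; have Sn n : spanned S (c *+ n).
  elim: n => [|n IHn]; first by rewrite mulr0n; apply: spanned0.
  by rewrite mulrS; apply: spanned_add.
case: k => n; first by rewrite -pmulrn.
by rewrite NegzE mulrNz -pmulrn; apply/spanned_opp.
Qed.

Lemma spannedT c : spanned (fun=> True) c.
Proof.
rewrite -(freeg_sumE c); apply: spanned_sum => s _.
have -> : << coeff s c *g s >> = << s >> *~ coeff s c :> tchain T.
  by rewrite freegU_mulz intz.
exact/spanned_mulz/spannedU.
Qed.

Definition lin (M : zmodType) (f : seq T -> M) (c : tchain T) : M :=
  @fglift int (zmodule M) (seq T) f c.

Lemma lin_is_additive (M : zmodType) (f : seq T -> M) : additive (lin f).
Proof. by move=> x y; apply: (@lift_is_additive int (seq T) (zmodule M) f). Qed.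

HB.instance Definition _ (M : zmodType) (f : seq T -> M) :=
  GRing.isZmodMorphism.Build (tchain T) M (lin f) (@lin_is_additive M f).

Lemma linU (M : zmodType) (f : seq T -> M) s : lin f << s >> = f s.
Proof. by rewrite /lin liftU scale1r. Qed.

Lemma eq_spanned (M : zmodType) (f g : {additive tchain T -> M}) S c :
  (forall s, S s -> f << s >> = g << s >>) -> spanned S c -> f c = g c.
Proof.
move=> fg; elim=> [|d s _ IH Ss|d s _ IH Ss]; first by rewrite !raddf0.
  by rewrite !raddfD IH fg.
by rewrite !raddfB IH fg.
Qed.

End TupleChains.

Section Boundary.
Variable T : choiceType.
Implicit Types (s : seq T) (c : tchain T).

Lemma spanned_lin (T' : choiceType) (S : seq T -> Prop) (S' : seq T' -> Prop)
    (f : seq T -> tchain T') c :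
  (forall s, S s -> spanned S' (f s)) -> spanned S c -> spanned S' (lin f c).
Proof.
move=> fS; elim=> [|d s _ IH Ss|d s _ IH Ss].
- by rewrite raddf0; apply: spanned0.
- by rewrite raddfD /= linU; apply: spanned_add => //; apply: fS.
- by rewrite raddfB /= linU; apply/spanned_add/spanned_opp => //; apply: fS.
Qed.

Definition tcone (x : T) : tchain T -> tchain T := lin (fun s => << x :: s >>).

HB.instance Definition _ x := GRing.Additive.on (tcone x).

(* The alternating sum of faces, in recursive form. *)
Fixpoint tface (s : seq T) : tchain T :=
  if s is x :: s' then << s' >> - tcone x (tface s') else 0.

Definition tbd : tchain T -> tchain T := lin tface.

HB.instance Definition _ := GRing.Additive.on tbd.

Lemma tconeU x s : tcone x << s >> = << x :: s >>.
Proof. exact: linU. Qed.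

Lemma tbdU s : tbd << s >> = tface s.
Proof. exact: linU. Qed.

Lemma tface_cons x s : tface (x :: s) = << s >> - tcone x (tface s).
Proof. by []. Qed.

(** The augmentation makes the formula hold in every degree: the boundary of a one-point tuple is
    the empty tuple, not 0. *)
Lemma tbd_cone x c : tbd (tcone x c) = c - tcone x (tbd c).
Proof.
elim: (spannedT c) => [|d s _ IH _|d s _ IH _]; first by rewrite !raddf0 ?addr0.
  by rewrite !raddfD /= IH tconeU !tbdU tface_cons addrACA.
by rewrite !raddfB /= IH tconeU !tbdU tface_cons raddfB addrACA.
Qed.

Lemma tbd_face s : tbd (tface s) = 0.
Proof.
elim: s => [|x s IHs]; first by rewrite raddf0.
by rewrite tface_cons raddfB /= tbd_cone IHs raddf0 subr0 tbdU subrr.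
Qed.

Lemma spanned_face s :
  spanned (fun s' => (size s').+1 = size s /\ {subset s' <= s}) (tface s).
Proof.
elim: s => [|x s IHs]; first exact: spanned0.
rewrite tface_cons; apply: spanned_add.
  by apply: spannedU; split=> // y ys; rewrite inE ys orbT.
apply/spanned_opp/spanned_lin/IHs => s' [ss' s's]; apply: spannedU; split=> [|y]; first by rewrite /= ss'.
by rewrite !inE => /orP[->//|/s's ->]; rewrite orbT.
Qed.

End Boundary.

Arguments tface [T] s : simpl never.

(** * Maps of tuples and the prism homotopy *)

Section Push.
Variables T T' : choiceType.

Definition tpush (f : T -> T') : tchain T -> tchain T' :=
  lin (fun s => << map f s >>).

HB.instance Definition _ f := GRing.Additive.on (tpush f).

Lemma tpushU f s : tpush f << s >> = << map f s >>.
Proof. exact: linU. Qed.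

Lemma tpush_cone f x c : tpush f (tcone x c) = tcone (f x) (tpush f c).
Proof.
elim: (spannedT c) => [|d s _ IH _|d s _ IH _]; first by rewrite !raddf0.
  by rewrite !raddfD /= IH tconeU !tpushU tconeU.
by rewrite !raddfB /= IH tconeU !tpushU tconeU.
Qed.

Lemma tpush_face f s : tpush f (tface s) = tface (map f s).
Proof.
elim: s => [|x s IHs]; first by rewrite raddf0.
by rewrite /= !tface_cons raddfB /= tpush_cone IHs tpushU.
Qed.

Lemma tpush_bd f c : tpush f (tbd c) = tbd (tpush f c).
Proof.
elim: (spannedT c) => [|d s _ IH _|d s _ IH _]; first by rewrite !raddf0.
  by rewrite !raddfD /= IH tpushU !tbdU tpush_face.
by rewrite !raddfB /= IH tpushU !tbdU tpush_face.
Qed.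

Variables a b : T -> T'.

(** Recursive form of the classical prism: the sum over i of (-1)^i times the tuple a x_0, ..., a
    x_i, b x_i, ..., b x_k. *)
Fixpoint tprism_tuple (s : seq T) : tchain T' :=
  if s is x :: s' then
    << a x :: b x :: map b s' >> - tcone (a x) (tprism_tuple s')
  else 0.

Definition tprism : tchain T -> tchain T' := lin tprism_tuple.

HB.instance Definition _ := GRing.Additive.on tprism.

Lemma tprismU s : tprism << s >> = tprism_tuple s.
Proof. exact: linU. Qed.

Lemma tprism_cone x c : tprism (tcone x c) =
  tcone (a x) (tcone (b x) (tpush b c)) - tcone (a x) (tprism c).
Proof.
elim: (spannedT c) => [|d s _ IH _|d s _ IH _]; first by rewrite !raddf0 ?addr0.
  by rewrite !raddfD /= IH tconeU tpushU !tprismU !tconeU /= addrACA.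
by rewrite !raddfB /= IH tconeU tpushU !tprismU !tconeU /= raddfB addrACA.
Qed.

Lemma tbd_prism_tuple s :
  tbd (tprism_tuple s) + tprism (tface s) = << map b s >> - << map a s >>.
Proof.
elim: s => [|x s IHs]; first by rewrite !raddf0 ?addr0 ?subrr.
rewrite /= tface_cons !raddfB /= tprism_cone tprismU !tbd_cone.
rewrite tbdU !tface_cons tpush_face -!tconeU !raddfB /=.
move/(congr1 (tcone (a x))): IHs; rewrite raddfD raddfB /= !tconeU => IHs.
set X := << a x :: map b s >> in IHs *; set K := tcone (a x) (tcone _ _).
set Y := tcone _ _ in IHs *; set Z := tcone _ _ in IHs *; set P := tprism_tuple s.
rewrite -[in RHS](subKr X <<a x :: map a s>>) -IHs !opprK opprB !addrA.
by rewrite [LHS](ACl (1*5*8*2*(3*7)*(4*6))) /= subrr addNr !addr0.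
Qed.

Lemma tbd_prism c : tbd (tprism c) + tprism (tbd c) = tpush b c - tpush a c.
Proof.
elim: (spannedT c) => [|d s _ IH _|d s _ IH _]; first by rewrite !raddf0 ?addr0.
  rewrite !raddfD /= addrACA IH tprismU tbdU tbd_prism_tuple !tpushU.
  by rewrite [RHS]addrACA.
rewrite !raddfB /= addrACA -opprD IH tprismU tbdU tbd_prism_tuple !tpushU.
by rewrite opprD addrACA.
Qed.

Lemma spanned_prism s :
  spanned (fun s' => size s' = (size s).+1 /\
    forall y, y \in s' -> exists2 x, x \in s & y = a x \/ y = b x)
    (tprism_tuple s).
Proof.
elim: s => [|x s IHs]; first exact: spanned0.
rewrite /=; apply: spanned_add.
  apply: spannedU; split=> [|y]; first by rewrite /= size_map.
  rewrite !inE => /or3P[/eqP->|/eqP->|/mapP[z zs ->]].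
  - by exists x; rewrite ?mem_head; [|left].
  - by exists x; rewrite ?mem_head; [|right].
  - by exists z; rewrite ?inE ?zs ?orbT; [|right].
apply/spanned_opp/(spanned_lin _ IHs) => s' [ss' s's].
apply: spannedU; split=> /= [|y]; first by rewrite ss'.
rewrite inE => /orP[/eqP->|/s's[z zs zE]]; first by exists x; rewrite ?mem_head; [|left].
by exists z => //; rewrite inE zs orbT.
Qed.

End Push.

(** * Simplicial chains *)

Section SetChains.
Variable m : nat.
Implicit Types (s t : {set 'I_m}) (c : chain m) (v w : 'I_m).

HB.instance Definition _ := GRing.Zmodule.on (chain m).

Definition schain s : chain m := [ffun t => (t == s)%:R].

Definition slin (W : zmodType) (h : {set 'I_m} -> W) (c : chain m) : W :=
  \sum_s h s *~ c s.

Lemma slin_is_additive (W : zmodType) (h : {set 'I_m} -> W) : additive (slin h).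
Proof.
move=> x y; rewrite /slin -sumrB; apply: eq_bigr => s _.
by rewrite !ffunE mulrzBr.
Qed.

HB.instance Definition _ (W : zmodType) (h : {set 'I_m} -> W) :=
  GRing.isZmodMorphism.Build (chain m) W (slin h) (@slin_is_additive W h).

Lemma slin1 (W : zmodType) (h : {set 'I_m} -> W) s : slin h (schain s) = h s.
Proof.
rewrite /slin (bigD1 s) //= ffunE eqxx big1 ?addr0 // => t ts.
by rewrite ffunE (negPf ts).
Qed.

Lemma slin_id c : slin schain c = c.
Proof.
apply/ffunP => t; rewrite /slin sum_ffunE (bigD1 t) //= big1 => [|s ts].
  by rewrite ffunMzE ffunE eqxx addr0 intz.
by rewrite ffunMzE ffunE eq_sym (negPf ts) mul0rz.
Qed.

Lemma raddf_slin (W W' : zmodType) (F : {additive W -> W'})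
  (h : {set 'I_m} -> W) c : F (slin h c) = slin (F \o h) c.
Proof. by rewrite raddf_sum; apply: eq_bigr => s _; rewrite raddfMz. Qed.

Lemma additive_slin (W : zmodType) (F : {additive chain m -> W}) c :
  F c = slin (F \o schain) c.
Proof. by rewrite -{1}[c]slin_id raddf_slin. Qed.

Lemma eq_slin (W : zmodType) (h h' : {set 'I_m} -> W) c :
  (forall s, c s != 0 -> h s = h' s) -> slin h c = slin h' c.
Proof.
by move=> hh; apply: eq_bigr => s _; have [->//|/hh ->] := eqVneq (c s) 0.
Qed.

Lemma slinB (W : zmodType) (h h' : {set 'I_m} -> W) c :
  slin (fun s => h s - h' s) c = slin h c - slin h' c.
Proof. by rewrite /slin -sumrB; apply: eq_bigr => s _; rewrite mulrzBl. Qed.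

Definition sface s : chain m := \sum_(v in s) schain (s :\ v) *~ bsign v s.

(** This boundary knows neither the complex nor the dimension: one additive map serves all
    subcomplexes of the full simplex, and [bdE] identifies it with [bd D k] on the chains of [D]. *)
Definition sbd : chain m -> chain m := slin sface.

HB.instance Definition _ := GRing.Additive.on sbd.

(* Exterior multiplication by the vertex [v]. *)
Definition sext v : chain m -> chain m :=
  slin (fun s => if v \in s then 0 else schain (v |: s) *~ bsign v s).

HB.instance Definition _ v := GRing.Additive.on (sext v).

Lemma sbd1 s : sbd (schain s) = sface s.
Proof. exact: slin1. Qed.

Lemma slin_homotopy h c :
  slin (fun s => schain s - slin h (sface s)) c = c - slin h (sbd c).
Proof. by rewrite slinB slin_id [slin h (sbd c)]raddf_slin. Qed.

Lemma sext1 v s :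
  sext v (schain s) = if v \in s then 0 else schain (v |: s) *~ bsign v s.
Proof. exact: slin1. Qed.

Lemma bsignU1 v w s : w \notin s ->
  bsign v (w |: s) = (if (w < v)%N then -1 else 1) * bsign v s.
Proof.
move=> ws; rewrite /bsign.
have [wv|wv] := ifPn.
  have -> : [set u in w |: s | (val u < val v)%N] =
      w |: [set u in s | (val u < val v)%N].
    by apply/setP => u; rewrite !inE; case: eqVneq => [->|].
  by rewrite cardsU1 !inE (negPf ws) exprS.
have -> : [set u in w |: s | (val u < val v)%N] =
    [set u in s | (val u < val v)%N].
  by apply/setP => u; rewrite !inE; case: eqVneq => [->|//]; rewrite (negPf wv) !andbF.
by rewrite mul1r.
Qed.

Lemma bsignD1 v s : bsign v (s :\ v) = bsign v s.
Proof.
have [vs|vs] := boolP (v \in s); last first.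
  by rewrite (setDidPl _) // disjoint_sym disjoints1.
by rewrite -[in RHS](setD1K vs) bsignU1 ?setD11// ltnn mul1r.
Qed.

Lemma bsign_sq v s : bsign v s * bsign v s = 1.
Proof. by rewrite -expr2 sqrr_sign. Qed.

(** Exactly one of [v], [w] precedes the other, so exactly one of the two signs changes when the
    other vertex is added or removed. *)
Lemma bsign_swap v w s : v \notin s -> w \in s ->
  bsign w (v |: s) * bsign v s = - (bsign v (s :\ w) * bsign w s).
Proof.
move=> vs ws; have wv : w != v by apply: contraNneq vs => <-.
rewrite bsignU1 // -[in bsign v s](setD1K ws) bsignU1 ?setD11 //.
have [vw|wv'|e] := ltngtP v w; last by move: wv; rewrite -val_eqE /= e eqxx.
  by rewrite mul1r mulN1r mulNr mulrC.
by rewrite mul1r mulN1r mulrN mulrC.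
Qed.

(** Exterior multiplication contracts the full simplex. If [v] is in [s], only the face [s :\ v]
    survives multiplication by [v]. Otherwise removing [v] from [v |: s] returns [s], and the
    remaining terms cancel in pairs by [bsign_swap]. *)
Lemma sbd_ext v c : sbd (sext v c) + sext v (sbd c) = c.
Proof.
have -> : sbd (sext v c) = slin (fun s => sbd (sext v (schain s))) c.
  exact: (additive_slin (sbd \o sext v)).
have -> : sext v (sbd c) = slin (fun s => sext v (sbd (schain s))) c.
  exact: (additive_slin (sext v \o sbd)).
rewrite -[RHS]slin_id /slin -big_split; apply: eq_bigr => s _ /=.
rewrite sbd1 sext1 /sface.
rewrite -mulrzDl; congr (_ *~ _).
have [vs|vs] := ifPn.
  rewrite raddf0 add0r raddf_sum (bigD1 v) //= big1 => [|w /andP[ws wv]].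
    rewrite raddfMz /= sext1 setD11 setD1K // -mulrzA bsignD1 bsign_sq addr0.
    exact: mulr1z.
  by rewrite raddfMz /= sext1 !inE eq_sym wv vs mul0rz.
rewrite raddfMz /= sbd1 /sface (big_setU1 _ vs) /= setU1K // mulrzDl -mulrzA.
rewrite bsignU1 // ltnn mul1r bsign_sq mulr1z -addrA; apply/eqP.
rewrite -subr_eq0 [X in X - _]addrC addrK addr_eq0; apply/eqP.
rewrite [sext v _]raddf_sum -sumrN mulrz_suml; apply: eq_bigr => w ws.
rewrite raddfMz /= sext1 !inE (negPf vs) andbF -!mulrzA -mulrNz.
have -> : (v |: s) :\ w = v |: (s :\ w).
  apply/setP => u; rewrite !inE; case: (eqVneq u v) => [->|//].
  by rewrite andbT; apply: contraNneq vs => ->.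
by rewrite bsign_swap.
Qed.

(** No double sum: a nonempty face is, up to sign, [v] times a smaller face, and the homotopy
    formula reduces the claim to that face. *)
Lemma sbdK c : sbd (sbd c) = 0.
Proof.
suff H s : sbd (sbd (schain s)) = 0.
  rewrite [LHS](additive_slin (@sbd \o @sbd)) /slin big1 // => s _ /=.
  by rewrite H mul0rz.
have [n] := ubnP #|s|; elim: n s => // n IHn s sn.
have [->|[v vs]] := set_0Vmem s; first by rewrite sbd1 /sface big_set0 raddf0.
have -> : schain s = sext v (schain (s :\ v)) *~ bsign v s.
  rewrite sext1 setD11 setD1K // -mulrzA bsignD1 bsign_sq; exact/esym/mulr1z.
have sE d : sbd (sext v d) = d - sext v (sbd d) by rewrite -{2}(sbd_ext v d) addrK.
rewrite !raddfMz /= sE raddfB /= sE IHn; last by rewrite (cardsD1 v) vs in sn.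
by rewrite raddf0 subr0 subrr mul0rz.
Qed.

Lemma chainsP (D : {set {set 'I_m}}) k c :
  chains D k c <-> (forall s, ~~ ((s \in D) && (#|s| == k)) -> c s = 0).
Proof.
split=> Dc s; first by apply: contraNeq; apply: Dc.
by apply: contraNT => /Dc ->.
Qed.

Lemma chains0 (D : {set {set 'I_m}}) k : chains D k 0.
Proof. by move=> s; rewrite ffunE eqxx. Qed.

Lemma chains_add (D : {set {set 'I_m}}) k c c' :
  chains D k c -> chains D k c' -> chains D k (c + c').
Proof.
by move=> /chainsP Dc /chainsP Dc'; apply/chainsP => s sD; rewrite ffunE Dc ?Dc'.
Qed.

Lemma chains_opp (D : {set {set 'I_m}}) k c : chains D k c -> chains D k (- c).
Proof. by move=> /chainsP Dc; apply/chainsP => s sD; rewrite ffunE Dc ?oppr0. Qed.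

Lemma chains_mulz (D : {set {set 'I_m}}) k c (z : int) :
  chains D k c -> chains D k (c *~ z).
Proof. by move=> /chainsP Dc; apply/chainsP => s sD; rewrite ffunMzE Dc ?mul0rz. Qed.

Lemma chains_sum (I : Type) (r : seq I) (P : pred I) (D : {set {set 'I_m}}) k
    (F : I -> chain m) :
  (forall i, P i -> chains D k (F i)) -> chains D k (\sum_(i <- r | P i) F i).
Proof. by move=> DF; apply: big_ind => //; [apply: chains0|apply: chains_add]. Qed.

Lemma chains1 (D : {set {set 'I_m}}) s : s \in D -> chains D #|s| (schain s).
Proof. by move=> sD t; rewrite ffunE; case: (t =P s) => [->|]; rewrite ?sD ?eqxx. Qed.

Lemma chains_slin (D D' : {set {set 'I_m}}) k l (h : {set 'I_m} -> chain m) c :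
  (forall s, s \in D -> #|s| = k -> chains D' l (h s)) ->
  chains D k c -> chains D' l (slin h c).
Proof.
move=> Dh Dc; apply: chains_sum => s _.
have [->|/Dc/andP[sD /eqP sk]] := eqVneq (c s) 0; first exact: chains0.
exact/chains_mulz/Dh.
Qed.

Lemma chains_sub (D D' : {set {set 'I_m}}) k c :
  {subset D <= D'} -> chains D k c -> chains D' k c.
Proof. by move=> DD' Dc s /Dc/andP[/DD' ->]. Qed.

Lemma sface_chains (D : {set {set 'I_m}}) s : simplicial_complex D -> s \in D ->
  forall k, #|s| = k.+1 -> chains D k (sface s).
Proof.
move=> [_ cD] sD k sk; apply: chains_sum => v vs; apply: chains_mulz.
have -> : k = #|s :\ v| by move: sk; rewrite (cardsD1 v) vs => -[].
by apply/chains1/(cD _ _ sD); apply: subsetDl.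
Qed.

Lemma sbd_chains (D : {set {set 'I_m}}) k c : simplicial_complex D ->
  chains D k.+1 c -> chains D k (sbd c).
Proof. by move=> cD; apply: chains_slin => s sD sk; apply: sface_chains. Qed.

Lemma sface0 : sface (set0 : {set 'I_m}) = 0.
Proof. by rewrite /sface big_set0. Qed.

Lemma bd_coefE (D : {set {set 'I_m}}) k t s :
  bd_coef D k t s = if (s \in D) && (#|s| == k) then sface s t else 0.
Proof.
rewrite /bd_coef; case: ifP => // _; rewrite /sface sum_ffunE.
apply: eq_bigr => v vs; rewrite ffunMzE ffunE.
by case: eqP => _; rewrite ?mul0rz // intz.
Qed.

Lemma bdE (D : {set {set 'I_m}}) k c : chains D k c -> bd D k c = sbd c.
Proof.
move=> Dc; apply/ffunP => t; rewrite ffunE /sbd /slin sum_ffunE.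
apply: eq_bigr => s _; rewrite bd_coefE ffunMzE.
by have [->|/Dc ->] := eqVneq (c s) 0; rewrite ?mulr0 ?mulr0z ?mulrzz.
Qed.

(** * The integer pairing and the transposed boundary *)

Definition dot (c c' : chain m) : int := \sum_s c s * c' s.

Lemma dot_is_additive c : additive (dot c).
Proof.
move=> x y; rewrite /dot -sumrB; apply: eq_bigr => s _.
by rewrite !ffunE mulrBr.
Qed.

HB.instance Definition _ c :=
  GRing.isZmodMorphism.Build (chain m) int (dot c) (@dot_is_additive c).

Lemma dotC c c' : dot c c' = dot c' c.
Proof. by apply: eq_bigr => s _; rewrite mulrC. Qed.

Lemma dot1 c s : dot c (schain s) = c s.
Proof.
rewrite /dot (bigD1 s) //= ffunE eqxx mulr1 big1 ?addr0 // => t ts.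
by rewrite ffunE (negPf ts) mulr0.
Qed.

Lemma bdTE (D : {set {set 'I_m}}) k c s : bdT D k c s =
  if (s \in D) && (#|s| == k) then dot c (sface s) else 0.
Proof.
rewrite ffunE; under eq_bigr => t _ do rewrite bd_coefE.
case: ifP => _; last by rewrite big1 // => t _; rewrite mul0r.
by apply: eq_bigr => t _; rewrite mulrC.
Qed.

Lemma bdT_chains (D : {set {set 'I_m}}) k c : chains D k (bdT D k c).
Proof. by apply/chainsP => s sD; rewrite bdTE (negPf sD). Qed.

Lemma dot_bdT (D : {set {set 'I_m}}) k c c' : chains D k c' ->
  dot (bdT D k c) c' = dot c (sbd c').
Proof.
move=> Dc'; rewrite raddf_slin; apply: eq_bigr => s _ /=.
rewrite bdTE -mulrzz.
by have [->|/Dc' ->] := eqVneq (c' s) 0; rewrite ?mulr0 ?mulr0z.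
Qed.

(** [k] counts vertices and the empty face is a cell, so this is the vanishing of reduced homology
    in degree [k - 1]. *)
Definition sacyclic (D : {set {set 'I_m}}) (k : nat) : Prop := forall c,
  chains D k c -> sbd c = 0 -> exists2 b, chains D k.+1 b & sbd b = c.

End SetChains.

(** * The critical group from acyclicity of complements of facets *)

Section CriticalGroup.
Variables (m d : nat) (D : {set {set 'I_m}}).
Hypothesis complexD : simplicial_complex D.
Hypothesis dimD : forall s, s \in D -> (#|s| <= d.+1)%N.
Hypothesis acyclicD : forall s, s \in D -> #|s| = d.+1 ->
  forall k, sacyclic (D :\ s) k.
Implicit Types (s t : {set 'I_m}) (c : chain m).

Lemma chains_big c k : (d.+1 < k)%N -> chains D k c -> c = 0.
Proof.
move=> dk Dc; apply/ffunP => s; rewrite ffunE; apply/eqP.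
apply: contraTT dk => /Dc/andP[sD /eqP <-]; rewrite -leqNgt; exact: dimD.
Qed.

Section Facet.
Variable s0 : {set 'I_m}.
Hypotheses (s0D : s0 \in D) (card_s0 : #|s0| = d.+1).
Local Notation K := (D :\ s0).

Let K_sub_D : {subset K <= D}. Proof. by move=> s /setD1P[]. Qed.

Let KD s : s \in D -> s != s0 -> s \in K. Proof. by move=> sD ss0; apply/setD1P. Qed.

Lemma complex_facetD1 : simplicial_complex K.
Proof.
have [D0 Dsub] := complexD; split.
  by apply: KD => //; apply: contra_eq_neq card_s0 => <-; rewrite cards0.
move=> s t /setD1P[ss0 sD] ts; apply: KD; first exact: Dsub sD ts.
apply: contraNneq ss0 => ts0; rewrite eq_sym -ts0 eqEcard ts ts0 card_s0.
exact: dimD.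
Qed.

Lemma chainsK k c : (k <= d)%N -> chains D k c -> chains K k c.
Proof.
move=> kd Dc s cs; have /andP[sD /eqP sk] := Dc s cs.
by rewrite sk eqxx andbT KD //; apply: contraTneq kd => ss0; rewrite -sk ss0 card_s0 ltnn.
Qed.

Lemma facet_cycle0 c : chains K d.+1 c -> sbd c = 0 -> c = 0.
Proof.
move=> Kc /(acyclicD s0D card_s0 Kc)[b Kb <-].
by rewrite (@chains_big b d.+2) ?raddf0 //; apply: chains_sub Kb.
Qed.

(* [slin h] is a contracting homotopy of the acyclic complex [K], hence a
   left inverse of the boundary map on its top-dimensional chains. *)
Lemma facet_contraction : exists h : {set 'I_m} -> chain m, forall t, t \in K ->
  chains K #|t|.+1 (h t) /\ sbd (h t) = schain t - slin h (sface t).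
Proof.
have KC := complex_facetD1; have [_ Ksub] := KC.
pose Q (h : {set 'I_m} -> chain m) t (w : chain m) := t \in K ->
  chains K #|t|.+1 w /\ sbd w = schain t - slin h (sface t).
have facets t : t \in K -> t != set0 -> chains K #|t|.-1 (sface t).
  by move=> tK t0; apply: sface_chains => //; rewrite prednK // card_gt0.
apply: (@rank_choice _ _ (fun t => #|t|) Q 0) => [h h' t w hh' Qw tK|h t IH].
  have [Kw ->] := Qw tK; split=> //; congr (_ - _).
  have [->|t0] := eqVneq t set0; first by rewrite sface0 !raddf0.
  apply: eq_slin => s /(facets _ tK t0)/andP[_ /eqP st]; apply: hh'.
  by rewrite st prednK // card_gt0.
have [tK|/negP tK] := boolP (t \in K); last by exists 0.
have Kt : chains K #|t| (slin h (sface t)).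
  have [->|t0] := eqVneq t set0; first by rewrite sface0 raddf0; apply: chains0.
  apply: chains_slin (facets _ tK t0) => s sK st.
  have st' : #|s|.+1 = #|t| by rewrite st prednK // card_gt0.
  by have [] := IH s (eq_leq st') sK; rewrite -?st'.
have [||b Kb bE] := acyclicD s0D card_s0 (k := #|t|)
    (c := schain t - slin h (sface t)).
- by apply/chains_add/chains_opp => //; apply: chains1.
- rewrite raddfB /= sbd1; apply/eqP; rewrite subr_eq0; apply/eqP.
  have [->|t0] := eqVneq t set0; first by rewrite sface0 !raddf0.
  rewrite raddf_slin.
  rewrite (@eq_slin _ _ _ (fun s => schain s - slin h (sface s))); last first.
    move=> s /(facets _ tK t0)/andP[sK /eqP st] /=.
    have st' : #|s|.+1 = #|t| by rewrite st prednK // card_gt0.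
    by have [] := IH s (eq_leq st') sK; rewrite -?st'.
  transitivity (sface t - slin h (sbd (sface t))).
    by rewrite -sbd1 sbdK raddf0 subr0.
  by rewrite slin_homotopy.
by exists b.
Qed.

(** The cycle [z] is [s0] minus the filling of its boundary inside [K]. Up to cardinality [d] the
    chains of [D] and [K] coincide, so [slin h] is a homotopy for [D] as well. In the top degree it
    fails by a multiple of [z]: for a facet [s] other than [s0], the chain [s - h (bd s)] is a top
    cycle of [K], hence 0, and for [s0] it is [z]. In particular every top cycle [c] is [c s0] times
    [z]. *)
Lemma facet_contraction_cycle : exists (h : {set 'I_m} -> chain m) (z : chain m),
  [/\ chains D d.+1 z, z s0 = 1, sbd z = 0,
    forall c, chains D d c -> chains D d.+1 (slin h c) /\
      sbd (slin h c) = c - slin h (sbd c) &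
    forall c, chains D d.+1 c -> slin h (sbd c) = c - z *~ c s0].
Proof.
have [h hP] := facet_contraction; pose H := slin h.
have HP k c : (k <= d)%N -> chains D k c ->
    chains K k.+1 (H c) /\ sbd (H c) = c - H (sbd c).
  move=> kd /(chainsK kd) Kc; split.
    by apply: chains_slin Kc => s sK <-; have [] := hP s sK.
  rewrite raddf_slin (@eq_slin _ _ _ (fun s => schain s - H (sface s))).
    exact: slin_homotopy.
  by move=> s /Kc/andP[/hP[]].
have Dface s : s \in D -> #|s| = d.+1 -> chains D d (sface s).
  by move=> sD; apply: sface_chains.
exists h, (schain s0 - H (sface s0)).
have [Kb bE] := HP _ _ (leqnn d) (Dface _ s0D card_s0).
split.
- apply/chains_add/chains_opp; first by rewrite -card_s0; apply: chains1.
  exact: chains_sub Kb.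
- move/chainsP: Kb => Kb; rewrite !ffunE eqxx Kb ?subr0 //.
  by rewrite setD11.
- by rewrite raddfB /= sbd1 bE -sbd1 sbdK /H raddf0 subr0 subrr.
- by move=> c Dc; have [Kc ->] := HP _ _ (leqnn d) Dc; split => //; apply: chains_sub Kc.
move=> c Dc; rewrite [LHS](additive_slin (slin h \o @sbd m)).
set z := schain s0 - _.
transitivity (slin (fun s => schain s - z *~ (schain s s0)) c).
  apply: eq_slin => s /Dc/andP[sD /eqP sd] /=; rewrite sbd1 ffunE eq_sym.
  have [->|ss0] := eqVneq; first by rewrite mulr1z /z subKr.
  rewrite mulr0z subr0; have [Kb' bE'] := HP _ _ (leqnn d) (Dface _ sD sd).
  apply/eqP; rewrite eq_sym -subr_eq0; apply/eqP/facet_cycle0.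
    by apply/chains_add/chains_opp => //; rewrite -sd; apply/chains1/KD.
  by rewrite raddfB /= sbd1 bE' -sbd1 sbdK /H raddf0 subr0 subrr.
rewrite slinB slin_id; congr (_ - _).
rewrite /slin (bigD1 s0) //= ffunE eqxx mulr1z big1 ?addr0 // => s ss0.
by rewrite ffunE eq_sym (negPf ss0) mulr0z mul0rz.
Qed.

End Facet.
Lemma critical_group_of_acyclic_facets s0 : s0 \in D -> #|s0| = d.+1 ->
  quot_iso_Zmod (crit_ker D d) (crit_im D d) (num_faces D d).
Proof.
move=> s0D card_s0.
have [h [z [Dz zs0 bz hP cycP]]] := facet_contraction_cycle s0D card_s0.
pose H := slin h.
(* The cycle [z'] normalised at [s] is the multiple [z' s0] of [z]; evaluation at [s] gives 1 as a
   product of two integers, one of which is [z s]. *)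
have z_unit s : s \in D -> #|s| = d.+1 -> z s * z s = 1.
  move=> sD sd.
  have [h' [z' [Dz' z's bz' _ _]]] := facet_contraction_cycle sD sd.
  have := cycP _ Dz'; rewrite bz' raddf0 => /esym/eqP; rewrite subr_eq0 => /eqP z'E.
  have : z s * z' s0 = 1 by rewrite -z's [in RHS]z'E ffunMzE mulrzz.
  move/(congr1 absz)/eqP; rewrite abszM muln_eq1 => /andP[/eqP + _].
  by case: (z s) => [[|[]]|[]].
have zz : dot z z = (num_faces D d)%:Z.
  rewrite /dot /num_faces -sum1_card -natz natr_sum [RHS]big_mkcond /=.
  apply: eq_bigr => s _; rewrite inE.
  case: ifP => [/andP[sD /eqP sd]|sD]; first exact: z_unit.
  by move/chainsP: Dz => ->; rewrite ?sD ?mul0r.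
(* The preimage is the transpose of [h] applied to [c]: the value of its coboundary at [s] is the
   pairing of [c] with [h (bd s)], that is with [s] minus a multiple of [z]. *)
have cut c : chains D d.+1 c -> dot z c = 0 -> c = bdT D d.+1 [ffun t => dot c (h t)].
  move=> Dc zc; apply/ffunP => s; rewrite bdTE; case: ifP => [/andP[sD /eqP sd]|sD].
    have -> : dot [ffun t => dot c (h t)] (sface s) = dot c (H (sface s)).
      rewrite [RHS]raddf_slin; apply: eq_bigr => t _ /=.
      by rewrite ffunE mulrzz.
    rewrite -sbd1 /H cycP; last by rewrite -sd; apply: chains1.
    by rewrite raddfB raddfMz /= dot1 [dot c z]dotC zc mul0rz subr0.
  by move/chainsP: Dc => ->; rewrite ?sD.
have ker_bd c : crit_ker D d c -> chains D d c /\ sbd c = 0.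
  by move=> [Dc bc]; split=> //; rewrite -(bdE Dc).
split=> [a [b [Db ->]]|].
  have Dc := @sbd_chains _ _ _ _ complexD (@bdT_chains _ D d.+1 b).
  by rewrite (bdE (@bdT_chains _ D d.+1 b)); split=> //; rewrite (bdE Dc) sbdK.
exists (fun c => dot z (H c)); split=> [a b _ _|k|a /ker_bd[Da ba]].
- by rewrite /H !raddfD.
(* By the last property of [h], this class has value k (1 - n), which is k modulo n. *)
- exists (sbd (schain s0 *~ k)).
    have Ds0 : chains D d.+1 (schain s0 *~ k).
      by apply: chains_mulz; rewrite -card_s0; apply: chains1.
    have Dc := sbd_chains complexD Ds0.
    by split=> //; rewrite (bdE Dc) sbdK.
  rewrite /H [sbd _]raddfMz [slin h _]raddfMz /= cycP; last first.
    by rewrite -card_s0; apply: chains1.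
  rewrite ffunE eqxx mulr1z raddfMz raddfB /= dot1 zs0 zz mulrzBl intz mulrzz.
  by rewrite [_ * k]mulrC -mulNr addrC modzMDl.
have [DHa bHa] := hP _ Da; rewrite ba raddf0 subr0 in bHa.
split=> [[b [Db aE]]|].
  have DbT := @bdT_chains _ D d.+1 b.
  (* [H a] and [bdT D d.+1 b] have the same boundary [a], so they differ by a multiple of [z].
     Pairing with [z] kills the coboundary and leaves a multiple of <z, z> = n. *)
  have HaE : H a = bdT D d.+1 b + z *~ (H a - bdT D d.+1 b) s0.
    have /cycP : chains D d.+1 (H a - bdT D d.+1 b) by apply/chains_add/chains_opp.
    rewrite raddfB /= bHa aE (bdE DbT) subrr raddf0 => /esym/eqP.
    by rewrite subr_eq0 => /eqP <-; rewrite addrC subrK.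
  rewrite HaE raddfD raddfMz /= zz dotC dot_bdT // bz raddf0 add0r.
  by rewrite mulrzz mulrC modzMl mod0z.
rewrite mod0z => /dvdz_mod0P/dvdzP[q qE].
have DHaz : chains D d.+1 (H a - z *~ q).
  by apply/chains_add/chains_opp => //; apply: chains_mulz.
have zHa : dot z (H a - z *~ q) = 0.
  by rewrite raddfB raddfMz /= zz qE mulrzz mulrC subrr.
(* [H a - z *~ q] still has boundary [a] and is now orthogonal to [z], so [cut] applies. Its
   preimage is truncated to the faces of [D] with [d] vertices, as membership in [crit_im] demands;
   the coboundary on facets only sees those faces. *)
pose b : chain m := [ffun t => if (t \in D) && (#|t| == d)
  then dot (H a - z *~ q) (h t) else 0].
have aE : a = sbd (bdT D d.+1 b).
  rewrite -[bdT D d.+1 b](_ : H a - z *~ q = _).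
    by rewrite raddfB raddfMz /= bHa bz mul0rz subr0.
  rewrite [LHS]cut //; apply/ffunP => s; rewrite !bdTE.
  case: ifP => // /andP[sD /eqP sd]; apply: eq_bigr => t _; rewrite !ffunE.
  have [->|/(sface_chains complexD sD sd) ->//] := eqVneq (sface s t) 0.
  by rewrite !mulr0.
exists b; split; last by rewrite (bdE (@bdT_chains _ D d.+1 b)).
by move=> t; rewrite ffunE; case: ifP; rewrite ?eqxx.
Qed.

End CriticalGroup.

(** * Small tuples in Euclidean space *)

Local Open Scope R_scope.
Delimit Scope ring_scope with ring.

Lemma uniform_radius (I : eqType) (s : seq I) (P : I -> R -> Prop) :
  (forall a r r', 0 < r' <= r -> P a r -> P a r') ->
  (forall a, a \in s -> exists2 r, 0 < r & P a r) ->
  exists2 r, 0 < r & forall a, a \in s -> P a r.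
Proof.
move=> Pmono; elim: s => [|a s IHs] Ps; first by exists 1; [lra|].
have [|r r0 Pr] := IHs; first by move=> b bs; apply: Ps; rewrite inE bs orbT.
have [r' r'0 Pr'] := Ps a (mem_head _ _).
have m0 : 0 < Rmin r r' by apply: Rmin_glb_lt.
exists (Rmin r r') => // b; rewrite inE => /orP[/eqP->|bs].
  by apply: Pmono Pr'; split=> //; apply: Rmin_r.
by apply: Pmono (Pr b bs); split=> //; apply: Rmin_l.
Qed.

(** [{classic _}] equips the functions with the choice structure that generators of a free group
    must carry. *)
Definition pt (p : nat) : choiceType := {classic 'I_p -> R}.

Section FineChains.
Variable p : nat.
Implicit Types (x y : pt p) (U : pt p -> Prop).

Definition near (e : R) x y : Prop := forall i, Rabs (x i - y i) < e.

Definition fine U (e : R) (k : nat) (s : seq (pt p)) : Prop :=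
  [/\ size s = k, forall x, x \in s -> U x &
      forall x y, x \in s -> y \in s -> near e x y].

Definition homothety (c : pt p) (t : R) x : pt p := fun i => (1 - t) * x i + t * c i.

Definition star_shaped U c : Prop :=
  U c /\ forall x t, U x -> 0 <= t <= 1 -> U (homothety c t x).

Lemma near_homothety c e r t t' x y : 0 <= t <= 1 -> Rabs (t' - t) <= r ->
  (forall i, Rabs (x i - y i) + r * Rabs (y i - c i) < e) ->
  near e (homothety c t x) (homothety c t' y).
Proof.
move=> t01 tt' xy i; apply: Rle_lt_trans (xy i); rewrite /homothety.
have -> : (1 - t) * x i + t * c i - ((1 - t') * y i + t' * c i) =
  (1 - t) * (x i - y i) + (t' - t) * (y i - c i) by ring.
apply: Rle_trans (Rabs_triang _ _) _; rewrite !Rabs_mult.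
apply: Rplus_le_compat; last by apply: Rmult_le_compat_r => //; apply: Rabs_pos.
rewrite -[X in _ <= X]Rmult_1_l; apply: Rmult_le_compat_r; first exact: Rabs_pos.
by rewrite Rabs_pos_eq; lra.
Qed.

(** Smallness is a strict inequality and a chain involves finitely many tuples, so some room is
    left. The margin has the form asked for by [near_homothety]: homothety parameters may differ by
    up to [r] without exceeding [e]. *)
Lemma fine_radius U c e k d : spanned (fine U e k) d ->
  exists2 r, 0 < r & spanned (fun s => fine U e k s /\
    forall x y i, x \in s -> y \in s ->
      Rabs (x i - y i) + r * Rabs (y i - c i) < e) d.
Proof.
have tuple_radius s : fine U e k s -> exists2 r, 0 < r &
    forall x y i, x \in s -> y \in s -> Rabs (x i - y i) + r * Rabs (y i - c i) < e.
  move=> [_ _ se].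
  have [||r r0 rP] := @uniform_radius (pt p * pt p * 'I_p)%type
    [seq (q, i) | q <- [seq (x, y) | x <- s, y <- s], i <- enum 'I_p]
    (fun q r => Rabs (q.1.1 q.2 - q.1.2 q.2) + r * Rabs (q.1.2 q.2 - c q.2) < e).
  - move=> [[x y] i] r r' /= rr'; have := Rabs_pos (y i - c i); nra.
  - move=> q /allpairsP[[xy i] [/allpairsP[[x y] [/= xs ys ->]] _ ->]] /=.
    have xyi := se x y xs ys i; have ya := Rabs_pos (y i - c i).
    exists ((e - Rabs (x i - y i)) / (2 * (Rabs (y i - c i) + 1))).
      by apply: Rdiv_lt_0_compat; lra.
    set A := Rabs (y i - c i) in ya *; set B := Rabs _ in xyi *.
    have -> : (e - B) / (2 * (A + 1)) * A = (e - B) * (A / (2 * (A + 1))).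
      by field; lra.
    have : A / (2 * (A + 1)) < 1 by apply/Rlt_div_l; lra.
    by nra.
  exists r => // x y i xs ys; apply: (rP (x, y, i)).
  apply/allpairsP; exists ((x, y), i); split=> //=; last by rewrite mem_enum.
  by apply/allpairsP; exists (x, y).
have sub (r r' : R) (d' : tchain (pt p)) : 0 < r' <= r ->
    spanned (fun s => fine U e k s /\ forall x y i, x \in s -> y \in s ->
      Rabs (x i - y i) + r * Rabs (y i - c i) < e) d' ->
    spanned (fun s => fine U e k s /\ forall x y i, x \in s -> y \in s ->
      Rabs (x i - y i) + r' * Rabs (y i - c i) < e) d'.
  move=> rr'; apply: spanned_sub => s [sU sr]; split=> // x y i xs ys.
  by have := sr x y i xs ys; have := Rabs_pos (y i - c i); nra.
have min2 (r r' : R) : 0 < r -> 0 < r' -> 0 < Rmin r r' <= r /\ 0 < Rmin r r' <= r'.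
  move=> r0 r'0; have m0 : 0 < Rmin r r' by apply: Rmin_glb_lt.
  by split; split=> //; [apply: Rmin_l|apply: Rmin_r].
elim=> [|d' s _ [r r0 IH] Us|d' s _ [r r0 IH] Us].
- by exists 1; [lra|apply: spanned0].
- have [r' r'0 sr'] := tuple_radius s Us; have [m1 m2] := min2 r r' r0 r'0.
  exists (Rmin r r'); first by case: m1.
  apply: spanned_add; first exact: sub m1 IH.
  by apply: sub m2 _; apply: spannedU.
- have [r' r'0 sr'] := tuple_radius s Us; have [m1 m2] := min2 r r' r0 r'0.
  exists (Rmin r r'); first by case: m1.
  apply: spanned_add; first exact: sub m1 IH.
  by apply/spanned_opp; apply: sub m2 _; apply: spannedU.
Qed.

(** Coning directly at [c] would create large tuples. The cycle is instead shrunk towards [c] in [N]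
    equal steps, each so short that the prism between consecutive stages keeps the scale [e]; once
    every point has reached [c], coning is harmless. No scale is lost. *)
Lemma star_fill U c e k d : star_shaped U c ->
  0 < e -> spanned (fine U e k) d -> tbd d = 0%ring ->
  exists2 d', spanned (fine U e k.+1) d' & tbd d' = d.
Proof.
move=> [Uc starU] e0 /(fine_radius c)[r r0 dr] bd.
have [N [N0 Nr]] : exists N, 0 < INR N /\ / INR N <= r.
  have [n [n1 n2]] := archimed_cor1 r r0; exists n; split; last by lra.
  exact: lt_0_INR.
pose h j := homothety c (INR j / INR N).
have h01 j : (j <= N)%N -> 0 <= INR j / INR N <= 1.
  move=> /leP/le_INR jN; split.
    by apply: Rdiv_le_0_compat => //; apply: pos_INR.
  by apply/Rle_div_l; lra.
have step j : (j <= N)%N -> exists2 d', spanned (fine U e k.+1) d' &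
    tbd d' = (tpush (h j) d - d)%ring.
  elim: j => [_|j IHj jN].
    exists 0%ring; first exact: spanned0.
    have h0 : h 0%N = id.
      by apply/funext => x; apply/funext => i; rewrite /h /homothety /=; field; lra.
    have -> : tpush (h 0%N) d = d.
      rewrite h0; elim: (spannedT d) => [|a s _ IH _|a s _ IH _].
      + by rewrite raddf0.
      + by rewrite raddfD /= IH tpushU map_id.
      + by rewrite raddfB /= IH tpushU map_id.
    by rewrite raddf0 subrr.
  have [d' d'U d'E] := IHj (ltnW jN).
  exists (d' + tprism (h j) (h j.+1) d)%ring; last first.
    have := tbd_prism (h j) (h j.+1) d; rewrite bd raddf0 addr0 => pE.
    by rewrite raddfD /= pE d'E addrC addrA subrK.
  apply: spanned_add => //; apply: spanned_lin dr => s [[sk sU se] sr].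
  apply: spanned_sub (spanned_prism _ _ s) => s' [s's s'h]; split.
  - by rewrite s's sk.
  - move=> y /s'h[x xs [->|->]]; apply: starU; [exact: sU|exact/h01/ltnW|exact: sU|exact: h01].
  - have jj : INR j.+1 / INR N = INR j / INR N + / INR N.
      by rewrite S_INR; field; lra.
    have iN0 : 0 < / INR N by apply: Rinv_0_lt_compat.
    have lej := h01 j (ltnW jN); have lej1 := h01 j.+1 jN.
    move=> y1 y2 /s'h[x1 x1s [->|->]] /s'h[x2 x2s [->|->]];
      (apply: near_homothety; [exact: lej || exact: lej1 | |
       by move=> i; exact: (sr x1 x2 i x1s x2s)]).
    + by rewrite Rminus_diag Rabs_R0; lra.
    + by rewrite jj Rabs_pos_eq; lra.
    + by rewrite jj Rabs_minus_sym Rabs_pos_eq; lra.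
    + by rewrite Rminus_diag Rabs_R0; lra.
have [d' d'U d'E] := step N (leqnn N).
(* The cone has the collapsed cycle as boundary, and the accumulated prisms have that cycle minus
   [d]. *)
exists (tcone c (tpush (h N) d) - d')%ring; last first.
  by rewrite raddfB /= tbd_cone -tpush_bd bd !raddf0 addr0 d'E subKr.
apply: spanned_add; last exact: spanned_opp.
have hN x : h N x = c.
  by apply/funext => i; rewrite /h /homothety; field; lra.
apply: spanned_lin (_ : spanned (fun s => size s = k /\ forall x, x \in s -> x = c) _).
  move=> s [sk sc]; apply: spannedU; split=> [|x|x y].
  - by rewrite /= sk.
  - by rewrite inE => /orP[/eqP->|/sc->].
  - rewrite !inE => /orP[/eqP->|/sc->] /orP[/eqP->|/sc->] i;
    by rewrite Rminus_diag Rabs_R0.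
apply: spanned_lin dr => s [[sk _ _] _]; apply: spannedU; split.
  by rewrite size_map.
by move=> x /mapP[y _ ->].
Qed.

End FineChains.

Section LinComposition.
Variable T : choiceType.
Implicit Types (c : tchain T).

Lemma raddf_lin (M M' : zmodType) (F : {additive M -> M'}) (f : seq T -> M) c :
  F (lin f c) = lin (F \o f) c.
Proof.
elim: (spannedT c) => [|d s _ IH _|d s _ IH _]; first by rewrite !raddf0.
  by rewrite !raddfD /= IH !linU.
by rewrite !raddfB /= IH !linU.
Qed.

Lemma linB (M : zmodType) (f g : seq T -> M) c :
  lin (fun s => (f s - g s)%ring) c = (lin f c - lin g c)%ring.
Proof.
elim: (spannedT c) => [|d s _ IH _|d s _ IH _]; first by rewrite !raddf0 addr0.
  by rewrite !raddfD /= IH !linU addrACA.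
by rewrite !raddfB /= IH !linU opprD addrACA.
Qed.

Lemma lin_id c : lin (fun s => << s >>) c = c.
Proof.
elim: (spannedT c) => [|d s _ IH _|d s _ IH _]; first by rewrite raddf0.
  by rewrite raddfD /= IH linU.
by rewrite raddfB /= IH linU.
Qed.

Lemma eq_lin (M : zmodType) (f g : seq T -> M) S c :
  (forall s, S s -> f s = g s) -> spanned S c -> lin f c = lin g c.
Proof. by move=> fg; apply: (@eq_spanned _ _ (lin f) (lin g)) => s Ss; rewrite /= !linU fg. Qed.

End LinComposition.

HB.instance Definition _ := Monoid.isComLaw.Build R R0 Rplus
  (fun x y z => esym (Rplus_assoc x y z)) Rplus_comm Rplus_0_l.

Lemma rsumE n (x : 'I_n -> R) (a : R) : rsum (fun i => a * x i) = a * rsum x.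
Proof.
by rewrite /rsum; elim/big_rec2: _ => [|i y z _ ->]; [rewrite Rmult_0_r|rewrite Rmult_plus_distr_l].
Qed.

Lemma rsumD n (x y : 'I_n -> R) : rsum (fun i => x i + y i) = rsum x + rsum y.
Proof. exact: big_split. Qed.

Lemma rsum_ge0 n (x : 'I_n -> R) : (forall i, 0 <= x i) -> 0 <= rsum x.
Proof.
move=> x0; rewrite /rsum; elim/big_rec: _ => [|i y _ y0]; first exact: Rle_refl.
by have := x0 i; lra.
Qed.

Lemma rsum_indic n (v : 'I_n) : rsum (fun i => if i == v then 1 else 0) = 1.
Proof.
rewrite /rsum (bigD1 v) //= eqxx big1 ?Rplus_0_r // => i.
by case: eqP.
Qed.

(** * From simplices to small tuples and back *)

Section Cells.
Variable m : nat.
Implicit Types (x y : pt m) (s t : {set 'I_m}) (D : {set {set 'I_m}}).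

Definition supp x : {set 'I_m} := [set i | `[< 0 < x i >]].

Lemma in_supp x i : (i \in supp x) <-> 0 < x i.
Proof. by rewrite inE; split=> [/asboolP|?]; last apply/asboolP. Qed.

Lemma realizationE D x :
  realization D x <-> [/\ forall i, 0 <= x i, rsum x = 1 & supp x \in D].
Proof.
split=> [[x0 [x1 [s sD sx]]]|[x0 x1 xD]]; last first.
  by split=> //; split=> //; exists (supp x) => // i; apply: in_supp.
split=> //; suff -> : supp x = s by [].
apply/setP => i; apply/idP/idP => [/in_supp/sx//|/sx/in_supp//].
Qed.

Definition cell s x : Prop :=
  [/\ forall i, 0 <= x i, rsum x = 1 & supp x \subset s].

Lemma cell_sub s t x : s \subset t -> cell s x -> cell t x.
Proof. by move=> st [x0 x1 xs]; split=> //; apply: subset_trans st. Qed.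

Lemma cell_realization D s x : simplicial_complex D -> s \in D ->
  cell s x -> realization D x.
Proof. by move=> [_ cD] sD [x0 x1 xs]; apply/realizationE; split=> //; apply: cD xs. Qed.

Definition vertex (v : 'I_m) : pt m := fun i => if i == v then 1 else 0.

Lemma cell_star_shaped s v : v \in s -> star_shaped (cell s) (vertex v).
Proof.
move=> vs; split.
  split=> [i||]; rewrite /vertex; [by case: ifP => _; lra|exact: rsum_indic|].
  by apply/subsetP => i /in_supp; case: eqP => [->//|_ /Rlt_irrefl].
move=> x t [x0 x1 xs] t01; split=> [i||].
- rewrite /homothety; have := x0 i; rewrite /vertex; case: ifP => _; nra.
- by rewrite /homothety rsumD !rsumE x1 rsum_indic; ring.
- apply/subsetP => i; apply: contraTT => iS; apply/negP => /in_supp.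
  rewrite /homothety /vertex; case: eqP => [iv|_]; first by rewrite iv vs in iS.
  have xi0 : ~ 0 < x i by move=> /in_supp ix; move/negP: iS; apply; move/subsetP: xs; apply.
  by have := x0 i; nra.
Qed.

Lemma powerset_complex s : simplicial_complex (powerset s).
Proof.
split; first by rewrite powersetE sub0set.
by move=> t u; rewrite !powersetE => ts ut; apply: subset_trans ts.
Qed.

Lemma chains_powerset D s k c : simplicial_complex D -> s \in D ->
  chains (powerset s) k c -> chains D k c.
Proof.
move=> [_ cD] sD; apply: chains_sub => t; rewrite powersetE; exact: cD.
Qed.

(** Each closed cell is star-shaped about any of its vertices, so the subdivided boundary can be
    filled inside it. The clause on the empty face fixes the augmentation: the other two alone would
    admit [tau = 0]. *)
Lemma simplex_subdivision (e : R) : 0 < e -> exists tau : {set 'I_m} -> tchain (pt m),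
  forall s, [/\ spanned (fine (cell s) e #|s|) (tau s),
    tbd (tau s) = slin tau (sface s) & s = set0 -> tau s = << [::] >>].
Proof.
move=> e0.
pose Q (h : {set 'I_m} -> tchain (pt m)) s w :=
  [/\ spanned (fine (cell s) e #|s|) w,
    tbd w = slin h (sface s) & s = set0 -> w = << [::] >>].
have facets s : s != set0 -> chains (powerset s) #|s|.-1 (sface s).
  move=> s0; apply: (sface_chains (powerset_complex s)).
    by rewrite powersetE.
  by rewrite prednK // card_gt0.
apply: (@rank_choice _ _ (fun s => #|s|) Q 0%ring) => [h h' s w hh' [we wE w0]|h s IH].
  split=> //; rewrite wE; have [->|s0] := eqVneq s set0; first by rewrite sface0 !raddf0.
  apply: eq_slin => t /(facets _ s0)/andP[_ /eqP st]; apply: hh'.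
  by rewrite st prednK // card_gt0.
have [->|[v vs]] := set_0Vmem s.
  exists << [::] >>; split=> //; last by rewrite tbdU sface0 raddf0.
  by apply: spannedU; split=> //; rewrite cards0.
have s0 : s != set0 by apply/set0Pn; exists v.
have hP t : sface s t != 0%ring -> [/\ t \subset s, (#|t| < #|s|)%N & #|t|.+1 = #|s|].
  move=> /(facets _ s0)/andP[ts /eqP tS].
  have E : #|t|.+1 = #|s| by rewrite tS prednK // card_gt0.
  by rewrite powersetE in ts; rewrite -E.
have [||w we wE] := @star_fill _ (cell s) (vertex v) e #|s|.-1 (slin h (sface s))
    (cell_star_shaped vs) e0.
- apply: spanned_sum => t _.
  have [->|/hP[ts tlt tS]] := eqVneq (sface s t) 0%ring.
    by rewrite mulr0z; apply: spanned0.
  apply: spanned_mulz; have [te _ _] := IH t tlt.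
  apply: spanned_sub te => l [lk lU le]; split=> //; first by rewrite lk -tS.
  by move=> x /lU; apply: cell_sub.
- rewrite raddf_slin (@eq_slin _ _ _ (slin h \o @sface m)).
    by rewrite -[RHS](raddf0 (slin h)) -(sbdK (schain s)) sbd1 [in RHS]raddf_slin.
  by move=> t /hP[_ tlt _] /=; have [_ ->] := IH t tlt.
exists w; split=> //; first by rewrite prednK ?card_gt0 // in we.
by move=> sE; rewrite sE eqxx in s0.
Qed.

Section Wedge.
Variable phi : pt m -> 'I_m.
Hypothesis phiP : forall x, (forall i, 0 <= x i) -> rsum x = 1 -> / INR m <= x (phi x).

(** As an exterior product it is 0 on tuples that repeat a vertex, and it turns the order of the
    points into a sign. *)
Definition wedge_tuple (s : seq (pt m)) : chain m :=
  foldr (fun x => sext (phi x)) (schain set0) s.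

Definition wedge : tchain (pt m) -> chain m := lin wedge_tuple.

HB.instance Definition _ := GRing.Additive.on wedge.

Lemma wedgeU (s : seq (pt m)) : wedge << s >> = wedge_tuple s.
Proof. exact: linU. Qed.

Lemma wedge_cone x (c : tchain (pt m)) : wedge (tcone x c) = sext (phi x) (wedge c).
Proof.
elim: (spannedT c) => [|d s _ IH _|d s _ IH _]; first by rewrite !raddf0.
  by rewrite !raddfD /= IH tconeU !wedgeU.
by rewrite !raddfB /= IH tconeU !wedgeU.
Qed.

(** [sbd_ext] and the recursion defining [tface] are the same formula, one for exterior
    multiplication and one for cones. *)
Lemma sbd_wedge_tuple (s : seq (pt m)) : sbd (wedge_tuple s) = wedge (tface s).
Proof.
elim: s => [|x s IHs]; first by rewrite /= sbd1 sface0 raddf0.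
rewrite tface_cons raddfB /= wedge_cone -IHs wedgeU.
by apply/eqP; rewrite eq_sym subr_eq; apply/eqP/esym/sbd_ext.
Qed.

Lemma sbd_wedge c : sbd (wedge c) = wedge (tbd c).
Proof.
elim: (spannedT c) => [|d s _ IH _|d s _ IH _]; first by rewrite !raddf0.
  by rewrite !raddfD /= IH tbdU wedgeU sbd_wedge_tuple.
by rewrite !raddfB /= IH tbdU wedgeU sbd_wedge_tuple.
Qed.

Lemma wedge_tuple_chains s (l : seq (pt m)) :
  (forall x, x \in l -> phi x \in s) -> chains (powerset s) (size l) (wedge_tuple l).
Proof.
elim: l => [_|x l IHl ls] /=.
  by rewrite -(cards0 'I_m); apply: chains1; rewrite powersetE sub0set.
have := IHl (fun y yl => ls y (@mem_behead _ (x :: l) y yl)).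
apply: chains_slin => t; rewrite powersetE => ts tk.
have [xt|xt] := ifPn; first exact: chains0.
have -> : (size l).+1 = #|phi x |: t| by rewrite cardsU1 xt tk.
apply/chains_mulz/chains1; rewrite powersetE subUset ts sub1set andbT.
by apply: ls; rewrite mem_head.
Qed.

Lemma phi_supp x : (forall i, 0 <= x i) -> rsum x = 1 -> phi x \in supp x.
Proof.
move=> x0 x1; apply/in_supp; apply: Rlt_le_trans (phiP x0 x1).
apply: Rinv_0_lt_compat; apply: lt_0_INR; apply/ltP.
exact: leq_ltn_trans (ltn_ord (phi x)).
Qed.

(** A coordinate of at least 1/m cannot vanish within a distance less than 1/m. Hence all points of
    a small tuple choose vertices of the carrier face of any one of them, and their wedge stays in
    the complex. *)
Lemma phi_near_supp x y : (forall i, 0 <= y i) -> rsum y = 1 ->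
  near (/ INR m) x y -> phi y \in supp x.
Proof.
move=> y0 y1 /(_ (phi y)) xy; apply/in_supp.
by have := phiP y0 y1; move: xy; rewrite Rabs_minus_sym => /Rabs_def2; lra.
Qed.

Lemma wedge_chains D k c : simplicial_complex D ->
  spanned (fine (realization D) (/ INR m) k) c -> chains D k (wedge c).
Proof.
move=> cD; elim=> [|d s _ IH Ss|d s _ IH Ss]; first by rewrite raddf0; apply: chains0.
all: suff ws : chains D k (wedge_tuple s).
1,3: by rewrite ?raddfB ?raddfD /= wedgeU; apply: chains_add => //; apply: chains_opp.
all: case: Ss => <- sD se; case: s sD se => [|x s] sD se.
1,3: by rewrite /= -(cards0 'I_m); apply: chains1; case: cD.
all: have /realizationE[x0 x1 xD] := sD x (mem_head _ _).
all: apply: (chains_powerset cD xD); apply: wedge_tuple_chains => y ys.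
all: have /realizationE[y0 y1 _] := sD y ys.
all: by apply: phi_near_supp => //; apply: se; rewrite ?mem_head.
Qed.

(** The scale [e] is arbitrary, since the argument is one of support: [wedge (tau s)] lives on
    subsets of [s] with as many elements as [s], so it is a multiple of [s]. Its boundary is that of
    [s] by induction, and the coefficient of one face [s :\ v] makes the multiple 1. *)
Lemma wedge_subdivision (e : R) tau :
  (forall s, [/\ spanned (fine (cell s) e #|s|) (tau s),
    tbd (tau s) = slin tau (sface s) & s = set0 -> tau s = << [::] >>]) ->
  forall s, wedge (tau s) = schain s.
Proof.
move=> tauP s; have [n] := ubnP #|s|; elim: n s => // n IHn s sn.
have [->|[v vs]] := set_0Vmem s.
  by have [_ _ ->//] := tauP set0; rewrite wedgeU.
have [taus btau _] := tauP s.
have wl l : fine (cell s) e #|s| l -> chains (powerset s) #|s| (wedge << l >>).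
  move=> [<- lU _]; rewrite wedgeU; apply: wedge_tuple_chains => x /lU[x0 x1].
  by move/subsetP; apply; apply: phi_supp.
have ws : chains (powerset s) #|s| (wedge (tau s)).
  elim: taus => [|d l _ IH /wl lP|d l _ IH /wl lP].
  - by rewrite raddf0; apply: chains0.
  - by rewrite raddfD; apply: chains_add.
  - by rewrite raddfB; apply/chains_add/chains_opp.
have sS : #|s| = #|s|.-1.+1 by rewrite prednK // card_gt0; apply/set0Pn; exists v.
have sP : s \in powerset s by rewrite powersetE.
have sface_card t : sface s t != 0%ring -> (#|t| < n)%N.
  move=> /(sface_chains (powerset_complex s) sP sS)/andP[_ /eqP ->].
  by rewrite -ltnS -sS.
have bw : sbd (wedge (tau s)) = sface s.
  rewrite sbd_wedge btau raddf_slin (@eq_slin _ _ _ (@schain m)) ?slin_id // => t /sface_card.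
  exact: IHn.
have wE : wedge (tau s) = (schain s *~ wedge (tau s) s)%ring.
  apply/ffunP => t; rewrite ffunMzE ffunE; case: eqP => [->|ts]; first by rewrite intz.
  rewrite mul0rz; apply/eqP; apply: contra_notT ts => /ws/andP[].
  by rewrite powersetE => ts /eqP tS; apply/eqP; rewrite eqEcard ts tS /=.
have := congr1 (fun c : chain m => c (s :\ v)) bw; rewrite {1}wE raddfMz /= sbd1 ffunMzE.
have -> : sface s (s :\ v) = bsign v s.
  rewrite /sface sum_ffunE (bigD1 v) //= big1 => [|w /andP[ws' wv]].
    by rewrite ffunMzE ffunE eqxx addr0 intz.
  rewrite ffunMzE ffunE; case: eqP => [/setP/(_ w)|_]; last by rewrite mul0rz.
  by rewrite !inE eqxx wv ws'.
move/(congr1 (fun z => bsign v s * z)%ring); rewrite mulrzAr bsign_sq intz.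
by move=> l1; rewrite wE l1 mulr1z.
Qed.

End Wedge.
End Cells.

(** * Acyclicity at small scales and its transfer along retracts *)

Lemma rsum_const n (a : R) : rsum (fun _ : 'I_n => a) = INR n * a.
Proof.
rewrite /rsum big_const_ord; elim: n => [|n IHn]; first by rewrite /= Rmult_0_l.
by rewrite iterS IHn S_INR; ring.
Qed.

Lemma rsum_ge_term n (x : 'I_n -> R) i : (forall j, 0 <= x j) -> x i <= rsum x.
Proof.
move=> x0; rewrite /rsum (bigD1 i) //=.
rewrite -[X in X <= _]Rplus_0_r; apply: Rplus_le_compat_l.
by elim/big_rec: _ => [|j y _ y0]; [exact: Rle_refl|have := x0 j; lra].
Qed.

Lemma exists_large_coordinate m (v0 : 'I_m) : exists phi : pt m -> 'I_m,
  forall x, (forall i, 0 <= x i) -> rsum x = 1 -> / INR m <= x (phi x).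
Proof.
suff /choice[phi phiP] (x : pt m) : exists i,
    (forall i, 0 <= x i) -> rsum x = 1 -> / INR m <= x i by exists phi.
have [[i xi]|nx] := pselect (exists i, / INR m <= x i); first by exists i.
exists v0 => x0 x1; exfalso.
have m0 : 0 < INR m by apply: lt_0_INR; apply/ltP/leq_ltn_trans/(ltn_ord v0).
have xm i : x i < / INR m by apply: Rnot_le_lt => xi; apply: nx; exists i.
have := @rsum_ge_term m (fun i => / INR m + -1 * x i) v0.
rewrite rsumD rsumE rsum_const x1 Rinv_r; last by lra.
have := xm v0; suff : forall j, 0 <= / INR m + -1 * x j by move=> h ? /(_ h); lra.
by move=> j; have := xm j; lra.
Qed.

(** Two scales, as in Vietoris homology: the filling may be coarser than the cycle, provided its
    scale can be prescribed in advance. *)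
Definition fine_acyclic q (X : pt q -> Prop) (k : nat) : Prop :=
  forall e, 0 < e -> exists2 e', 0 < e' & forall c,
    spanned (fine X e' k) c -> tbd c = 0%ring ->
    exists2 c', spanned (fine X e k.+1) c' & tbd c' = c.

Definition unif_continuous_on p q (A : pt p -> Prop) (F : pt p -> pt q) : Prop :=
  forall e, 0 < e -> exists2 d, 0 < d & forall x x', A x -> A x' ->
    near d x x' -> near e (F x) (F x').

Lemma star_fine_acyclic q (X : pt q -> Prop) c k : star_shaped X c -> fine_acyclic X k.
Proof. by move=> sX e e0; exists e => // d dX bd; exact: star_fill sX e0 dX bd. Qed.

Lemma fineW q (X X' : pt q -> Prop) e e' k s : (forall x, X x -> X' x) ->
  e <= e' -> fine X e k s -> fine X' e' k s.
Proof.
move=> XX' ee' [sk sX se]; split=> // [x /sX/XX'//|x y xs ys i].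
exact: Rlt_le_trans (se x y xs ys i) ee'.
Qed.

Section Retract.
Variables (m : nat) (v0 : 'I_m) (K : {set {set 'I_m}}).
Hypothesis complexK : simplicial_complex K.

(** Scales are chosen backwards from 1/m: [e1] makes [G] land below 1/m, [e2] makes cycles of [X]
    fill below [e1], [e3] makes [F] land below [e2], and the subdivision is taken at [e3]. Since
    [G (F x) = x] pointwise, the subdivided chain comes back unchanged. *)
Lemma sacyclic_of_retract q (X : pt q -> Prop) k (F : pt m -> pt q) (G : pt q -> pt m) :
  (forall x, realization K x -> X (F x)) ->
  (forall y, X y -> realization K (G y)) ->
  (forall x, realization K x -> G (F x) = x) ->
  unif_continuous_on (realization K) F -> unif_continuous_on X G ->
  fine_acyclic X k -> sacyclic K k.
Proof.
move=> FX GK GF Fc Gc acX c Kc bc.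
have [phi phiP] := exists_large_coordinate v0.
have m0 : 0 < / INR m.
  by apply/Rinv_0_lt_compat/lt_0_INR/ltP/leq_ltn_trans/(ltn_ord v0).
have [e1 e10 e1P] := Gc _ m0.
have [e2 e20 e2P] := acX _ e10.
have [e3 e30 e3P] := Fc _ e20.
have [tau tauP] := @simplex_subdivision m _ e30.
have tauK : spanned (fine (realization K) e3 k) (slin tau c).
  apply: spanned_sum => s _; have [->|/Kc/andP[sK /eqP sk]] := eqVneq (c s) 0%ring.
    by rewrite mulr0z; apply: spanned0.
  apply: spanned_mulz; have [ts _ _] := tauP s; rewrite sk in ts.
  by apply: spanned_sub ts => l; apply: fineW; [move=> x; exact: cell_realization|lra].
have btau : tbd (slin tau c) = 0%ring.
  rewrite raddf_slin (@eq_slin _ _ _ (slin tau \o @sface m)).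
    by rewrite -[RHS](raddf0 (slin tau)) -bc [in RHS]raddf_slin.
  by move=> s _ /=; have [] := tauP s.
have [||w' w'X w'E] := e2P (tpush F (slin tau c)).
- apply: spanned_lin tauK => s [sk sK se]; apply: spannedU; split.
  + by rewrite size_map.
  + by move=> y /mapP[x /sK/FX xX ->].
  + by move=> y y' /mapP[x xs ->] /mapP[x' xs' ->]; apply: e3P; auto.
- by rewrite -tpush_bd btau raddf0.
exists (wedge phi (tpush G w')).
  apply: (wedge_chains phiP complexK); apply: spanned_lin w'X => s [sk sX se].
  apply: spannedU; split.
  + by rewrite size_map.
  + by move=> y /mapP[x /sX/GK xK ->].
  + by move=> y y' /mapP[x xs ->] /mapP[x' xs' ->]; apply: e1P; auto.
rewrite sbd_wedge -tpush_bd w'E.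
have -> : tpush G (tpush F (slin tau c)) = slin tau c.
  rewrite -[RHS]lin_id /tpush raddf_lin; apply: eq_lin tauK => s [_ sK _] /=.
  by rewrite linU -map_comp map_id_in // => x /sK/GF.
rewrite raddf_slin (@eq_slin _ _ _ (@schain m)) ?slin_id // => s _.
exact: (wedge_subdivision phiP tauP).
Qed.

(* Both the identity and subdivision-after-wedge are carried by the map sending
   a small tuple to the union of the cells of its points, which is star-shaped
   about any vertex of the common face; hence they are chain homotopic. *)
Lemma realization_fine_acyclic k : sacyclic K k -> fine_acyclic (realization K) k.
Proof.
move=> acK e e0; have [phi phiP] := exists_large_coordinate v0.
have m0 : 0 < / INR m.
  by apply/Rinv_0_lt_compat/lt_0_INR/ltP/leq_ltn_trans/(ltn_ord v0).
have [tau tauP] := @simplex_subdivision m _ e0.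
(* Below [e], a tuple is itself an admissible term of the homotopy; below 1/m, the vertices chosen
   by [phi] lie in the support of every point of the tuple. *)
pose e' := Rmin e (/ INR m); have e'e : e' <= e by apply: Rmin_l.
have e'm : e' <= / INR m by apply: Rmin_r.
exists e'; first exact: Rmin_glb_lt.
pose U (s : seq (pt m)) (y : pt m) := exists2 x, x \in s & cell (supp x) y.
pose sd s := slin tau (wedge_tuple phi s).
pose small s := fine (realization K) e' (size s) s.
pose Q (h : seq (pt m) -> tchain (pt m)) s (w : tchain (pt m)) := small s ->
  spanned (fine (U s) e (size s).+1) w /\
  tbd w = (<< s >> - sd s - lin h (tface s))%ring.
have small_face s s' : small s -> (size s').+1 = size s /\ {subset s' <= s} -> small s'.
  by move=> [_ sK se] [_ s's]; split=> // [x /s's/sK//|x y /s's xs /s's ys]; apply: se.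
have bd_sd s : tbd (sd s) = lin sd (tface s).
  rewrite /sd raddf_slin (@eq_slin _ _ _ (slin tau \o @sface m)); last first.
    by move=> t _ /=; have [] := tauP t.
  have -> : lin (fun s' => slin tau (wedge_tuple phi s')) (tface s) =
      slin tau (wedge phi (tface s)) by rewrite /wedge [RHS]raddf_lin.
  by rewrite -sbd_wedge_tuple [in RHS]raddf_slin.
have [h hP] : exists h, forall s, Q h s (h s).
  apply: (@rank_choice _ _ size Q 0%ring) => [h h' s w hh' Qw /Qw[wU ->]|h s IH].
    split=> //; congr (_ - _)%ring; apply: eq_lin (spanned_face s) => s' [s's _].
    by apply: hh'; rewrite -s's.
  have [ss|/asboolPn/asboolP] := pselect (small s); last by exists 0%ring.
  case: s IH ss => [_ _|x s IH ss].
    exists 0%ring; split; first exact: spanned0.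
    rewrite /sd /= slin1; have [_ _ ->//] := tauP set0.
    by rewrite /tface !raddf0 addr0 subrr.
  have [_ sK se] := ss.
  have xs := mem_head x s; have /realizationE[x0 x1 xK] := sK x xs.
  have starU : star_shaped (U (x :: s)) (vertex (phi x)).
    have phix y : y \in x :: s -> phi x \in supp y.
      move=> ys; apply: (phi_near_supp phiP) => // i.
      exact: Rlt_le_trans (se y x ys xs i) e'm.
    split; first by exists x => //; have [] := cell_star_shaped (phix x xs).
    move=> y t [z zs yz] t01; exists z => //.
    by have [_] := cell_star_shaped (phix z zs); apply.
  have [||w wU wE] := @star_fill _ _ _ e (size s).+1
    (<< x :: s >> - sd (x :: s) - lin h (tface (x :: s)))%ring starU e0.
  - apply: spanned_add; first apply: spanned_add.
    + apply: spannedU; split=> // [y ys|y z ys zs i].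
        by exists y => //; have /realizationE[y0 y1 _] := sK y ys.
      exact: Rlt_le_trans (se y z ys zs i) e'e.
    + apply: spanned_opp; apply: spanned_sum => t _.
      have [->|] := eqVneq (wedge_tuple phi (x :: s) t) 0%ring.
        by rewrite mulr0z; apply: spanned0.
      have wc : forall y, y \in x :: s -> phi y \in supp x.
        move=> y ys; have /realizationE[y0 y1 _] := sK y ys.
        apply: (phi_near_supp phiP) => // i.
        exact: Rlt_le_trans (se x y xs ys i) e'm.
      move=> /(wedge_tuple_chains wc)/andP[]; rewrite powersetE => tx /eqP tk.
      apply: spanned_mulz; have [tt _ _] := tauP t; rewrite tk in tt.
      apply: spanned_sub tt => l; apply: fineW; last by lra.
      by move=> y yt; exists x => //; apply: cell_sub yt.
    + apply/spanned_opp/(spanned_lin _ (spanned_face _)) => s' ss'.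
      have [sk s's] := ss'; have s'small := small_face _ _ ss ss'.
      have lts : (size s' < size (x :: s))%N by rewrite -sk.
      have [hs' _] := IH s' lts s'small; rewrite sk in hs'.
      apply: spanned_sub hs' => l; apply: fineW; last by lra.
      by move=> y [z /s's zs yz]; exists z.
  - have -> : tbd (<< x :: s >> - sd (x :: s) - lin h (tface (x :: s)))%ring =
        (tface (x :: s) - lin sd (tface (x :: s)) -
         tbd (lin h (tface (x :: s))))%ring by rewrite raddfB raddfB /= tbdU bd_sd.
    have -> : tbd (lin h (tface (x :: s))) =
        lin (fun s' => << s' >> - sd s' - lin h (tface s'))%ring (tface (x :: s)).
      rewrite raddf_lin; apply: eq_lin (spanned_face _) => s' ss' /=.
      have [sk _] := ss'; have lts : (size s' < size (x :: s))%N by rewrite -sk.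
      by have [] := IH s' lts (small_face _ _ ss ss').
    rewrite !linB lin_id.
    have -> : lin (fun s' => lin h (tface s')) (tface (x :: s)) = 0%ring.
      by rewrite -[RHS](raddf0 (lin h)) -(tbd_face (x :: s)) [in RHS]raddf_lin.
    by rewrite subr0 subrr.
  by exists w.
move=> c cK bc.
have [||b Kb bE] := acK (wedge phi c).
- apply: (wedge_chains phiP complexK); apply: spanned_sub cK => s.
  by apply: fineW.
- by rewrite sbd_wedge bc raddf0.
have hc : spanned (fine (realization K) e k.+1) (lin h c).
  apply: spanned_lin cK => s sK; have [sk sK' _] := sK.
  have ss : small s by rewrite /small sk.
  have [hs _] := hP s ss; rewrite sk in hs; apply: spanned_sub hs => l.
  apply: fineW; last by lra.
  by move=> y [x /sK'/realizationE[_ _ xK]]; apply: cell_realization.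
have bhc : tbd (lin h c) = (c - slin tau (wedge phi c))%ring.
  rewrite raddf_lin.
  rewrite (@eq_lin _ _ _ (fun s => << s >> - sd s - lin h (tface s))%ring _ _ _ cK); last first.
    by move=> s sK; have [sk _ _] := sK; have [] := hP s; rewrite /small ?sk.
  rewrite !linB lin_id.
  have -> : lin (fun s => lin h (tface s)) c = 0%ring.
    by rewrite -[RHS](raddf0 (lin h)) -bc [in RHS]raddf_lin.
  by rewrite subr0 /wedge [in RHS]raddf_lin.
(* The homotopy joins [c] to the subdivision of [wedge phi c], and that simplicial cycle bounds [b]
   in [K]. *)
exists (lin h c + slin tau b)%ring.
  apply: spanned_add => //; apply: spanned_sum => t _.
  have [->|/Kb/andP[tK /eqP tk]] := eqVneq (b t) 0%ring.
    by rewrite mulr0z; apply: spanned0.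
  apply: spanned_mulz; have [tt _ _] := tauP t; rewrite tk in tt.
  apply: spanned_sub tt => l; apply: fineW; last by lra.
  by move=> x; exact: cell_realization.
rewrite raddfD /= bhc -bE.
have -> : tbd (slin tau b) = slin tau (sbd b).
  rewrite raddf_slin (@eq_slin _ _ _ (slin tau \o @sface m)); last first.
    by move=> t _ /=; have [] := tauP t.
  by rewrite [in RHS]raddf_slin.
by rewrite subrK.
Qed.

End Retract.

(** * Compactness and continuity *)

Section Compactness.
Variable p : nat.
Implicit Types (x y : pt p) (A : pt p -> Prop).

(** One extraction per coordinate. The condition [n <= phi n] stands for strict monotonicity and is
    enough to preserve the limits already obtained. *)
Lemma bounded_subsequence (u : nat -> pt p) (M : R) (l : seq 'I_p) :
  (forall n i, Rabs (u n i) <= M) ->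
  exists (phi : nat -> nat) (y : pt p), (forall n, (n <= phi n)%N) /\
    forall i, i \in l -> Un_cv (fun n => u (phi n) i) (y i).
Proof.
move=> uM; elim: l => [|i l [phi [y [phin phiy]]]].
  by exists id, (fun=> 0).
have [a aP] := Bolzano_Weierstrass (fun n => u (phi n) i)
  (fun r => - M <= r <= M) (@compact_P3 _ _) (fun n => proj1 (Rabs_le_between _ _) (uM (phi n) i)).
have /choice[psi psiP] (n : nat) : exists k, (n <= k)%N /\
    Rabs (u (phi k) i - a) < / INR n.+1.
  have n0 : 0 < / INR n.+1 by apply/Rinv_0_lt_compat/lt_0_INR/ltP.
  have [k [nk ka]] := aP (disc a (mkposreal _ n0)) n (ex_intro _ (mkposreal _ n0) (fun _ h => h)).
  by exists k; split=> //; apply/leP.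
exists (phi \o psi), (fun j => if j == i then a else y j); split=> [n|j].
  by apply: leq_trans (phin _); have [] := psiP n.
rewrite inE; case: eqP => [-> _|_ /= jl] e e0.
  have [N [Ne N0]] := archimed_cor1 e e0.
  exists N => n /leP Nn; have [_] := psiP n => h; apply: Rlt_trans h _.
  apply: Rlt_trans Ne; apply: Rinv_lt_contravar; last by apply: lt_INR; apply/ltP.
  by apply: Rmult_lt_0_compat; apply: lt_0_INR => //; apply/ltP.
have [N NP] := phiy j jl e e0; exists N => n /leP Nn; apply: NP; apply/leP.
by apply: leq_trans Nn _; have [] := psiP n.
Qed.

Definition pt_closed A : Prop :=
  forall y, (forall e, 0 < e -> exists2 x, A x & near e x y) -> A y.

Definition pt_bounded A : Prop := exists M, forall x i, A x -> Rabs (x i) <= M.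

Lemma cluster_point A (u : nat -> pt p) : pt_closed A -> pt_bounded A ->
  (forall n, A (u n)) -> exists2 y, A y &
  forall e N, 0 < e -> exists2 n, (N <= n)%N & near e (u n) y.
Proof.
move=> clA [M bA] uA.
have [phi [y [phin phiy]]] := bounded_subsequence (enum 'I_p) (fun n i => bA (u n) i (uA n)).
have cl e N : 0 < e -> exists2 n, (N <= n)%N & near e (u n) y.
  move=> e0.
  have /choice[K KP] i : exists k, forall n, (k <= n)%N -> Rabs (u (phi n) i - y i) < e.
    have [k kP] := phiy i (mem_enum _ _) e e0.
    by exists k => n kn; apply: kP; apply/leP.
  pose n := (N + \max_i K i)%N.
  exists (phi n); first by apply: leq_trans (phin _); apply: leq_addr.
  move=> i; apply: KP; apply: leq_trans (leq_addl _ _); exact: (leq_bigmax i).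
exists y => //; apply: clA => e e0; have [n _ ny] := cl e 0%N e0.
by exists (u n).
Qed.

Lemma rdist_lt n (x y : 'I_n -> R) e : 0 < e ->
  rdist x y < e <-> (forall i, Rabs (x i - y i) < e).
Proof.
move=> e0; rewrite /rdist; split=> [xy i|xy]; last first.
  elim/big_rec: _ => // i r _ re; exact: Rmax_lub_lt.
apply: Rle_lt_trans xy; have := mem_index_enum i.
elim: (index_enum _) => // j l IHl; rewrite inE big_cons => /orP[/eqP->|/IHl il].
  exact: Rmax_l.
exact: Rle_trans il (Rmax_r _ _).
Qed.

Lemma continuous_onP q A (f : pt p -> pt q) : continuous_on A f <->
  forall x, A x -> forall e, 0 < e -> exists2 d, 0 < d &
    forall x', A x' -> near d x x' -> near e (f x) (f x').
Proof.
split=> cf x Ax e e0; have [d d0 dP] := cf x Ax e e0; exists d => // x' Ax'.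
  by move=> /(rdist_lt _ _ d0)/dP-/(_ Ax')/(rdist_lt _ _ e0).
by move=> /(rdist_lt _ _ d0)/dP-/(_ Ax')/(rdist_lt _ _ e0).
Qed.

Lemma heine q A (f : pt p -> pt q) : pt_closed A -> pt_bounded A ->
  continuous_on A f -> unif_continuous_on A f.
Proof.
move=> clA bA /continuous_onP cf e e0; apply: contrapT => nu.
have /choice[xx xxP] (n : nat) : exists xx : pt p * pt p,
    [/\ A xx.1, A xx.2, near (/ INR n.+1) xx.1 xx.2 & ~ near e (f xx.1) (f xx.2)].
  have n0 : 0 < / INR n.+1 by apply/Rinv_0_lt_compat/lt_0_INR/ltP.
  apply: contrapT => nx; apply: nu; exists (/ INR n.+1) => // x x' Ax Ax' xx'.
  by apply: contrapT => nf; apply: nx; exists (x, x').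
have [|y Ay yP] := @cluster_point A (fun n => (xx n).1) clA bA.
  by move=> n; have [] := xxP n.
have [|d d0 dP] := cf y Ay (e / 2); first by lra.
have [|N [Ne N0]] := archimed_cor1 (d / 2); first by lra.
have [|n Nn ny] := yP (d / 2) N; first by lra.
have [A1 A2 n12 []] := xxP n; move=> i.
have nd : / INR n.+1 < d / 2.
  apply: Rlt_trans Ne; apply: Rinv_lt_contravar; last by apply: lt_INR; apply/ltP.
  by apply: Rmult_lt_0_compat; apply: lt_0_INR => //; apply/ltP.
have near1 : near d y (xx n).1 by move=> j; have := ny j; rewrite Rabs_minus_sym; lra.
have near2 : near d y (xx n).2.
  move=> j; have := n12 j; have := ny j; split_Rabs; lra.
have := dP _ A1 near1 i; have := dP _ A2 near2 i; split_Rabs; lra.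
Qed.

Lemma continuous_on_bounded q A (f : pt p -> pt q) : pt_closed A -> pt_bounded A ->
  continuous_on A f -> exists M, forall x i, A x -> Rabs (f x i) <= M.
Proof.
move=> clA bA /continuous_onP cf; apply: contrapT => nb.
have /choice[xx xxP] (n : nat) : exists x, A x /\ exists i, INR n < Rabs (f x i).
  apply: contrapT => nx; apply: nb; exists (INR n) => x i Ax.
  by apply: Rnot_lt_le => lt; apply: nx; exists x; split=> //; exists i.
have [|y Ay yP] := cluster_point (u := xx) clA bA; first by move=> n; have [] := xxP n.
have [|d d0 dP] := cf y Ay 1; first by lra.
(* The sum bounds all coordinates of [f y] at once, and the added 1 is the continuity error around
   [y]. *)
pose B := rsum (fun i => Rabs (f y i)) + 1.
have [N NB] := INR_unbounded B.
have [n Nn ny] := yP d N d0; have [An [i ni]] := xxP n.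
have near1 : near d y (xx n) by move=> j; have := ny j; rewrite Rabs_minus_sym.
have := dP _ An near1 i.
have := @rsum_ge_term _ (fun i => Rabs (f y i)) i (fun j => Rabs_pos _).
have : INR N <= INR n by apply: le_INR; apply/leP.
by move: NB; rewrite /B; split_Rabs; lra.
Qed.

End Compactness.

(** * Continuity of real-valued formulas *)

Section ContinuityCalculus.
Variable p : nat.
Variable A : pt p -> Prop.
Implicit Types (h k : pt p -> R).

Definition creal h : Prop := forall x, A x -> forall e, 0 < e ->
  exists2 d, 0 < d & forall x', A x' -> near d x x' -> Rabs (h x - h x') < e.

Lemma near_min (d d' : R) (x x' : pt p) : near (Rmin d d') x x' -> near d x x' /\ near d' x x'.
Proof.
by move=> n; split=> i; apply: Rlt_le_trans (n i) _; [apply: Rmin_l|apply: Rmin_r].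
Qed.

Lemma creal_const (a : R) : creal (fun=> a).
Proof. by move=> x _ e e0; exists 1; [lra|] => x' _ _; rewrite Rminus_diag Rabs_R0. Qed.

Lemma creal_coord i : creal (fun x => x i).
Proof. by move=> x _ e e0; exists e => // x' _ /(_ i). Qed.

Lemma creal_comp (g : R -> R) h : creal h ->
  (forall x, A x -> continuity_pt g (h x)) -> creal (fun x => g (h x)).
Proof.
move=> ch cg x Ax e e0; have [r [r0 rP]] := cg x Ax e e0.
have [d d0 dP] := ch x Ax r r0; exists d => // x' Ax' xx'.
have [->|ne] := pselect (h x' = h x); first by rewrite Rminus_diag Rabs_R0.
rewrite Rabs_minus_sym; apply: rP; split; first by split=> // hE; apply: ne.
by rewrite /= /R_dist Rabs_minus_sym; apply: dP.
Qed.

Lemma creal_add h k : creal h -> creal k -> creal (fun x => h x + k x).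
Proof.
move=> ch ck x Ax e e0.
have [|d d0 dP] := ch x Ax (e / 2); first by lra.
have [|d' d'0 d'P] := ck x Ax (e / 2); first by lra.
exists (Rmin d d') => [|x' Ax' /near_min[n n']]; first exact: Rmin_glb_lt.
by have := dP x' Ax' n; have := d'P x' Ax' n'; split_Rabs; lra.
Qed.

Lemma creal_scal (a : R) h : creal h -> creal (fun x => a * h x).
Proof.
move=> ch; apply: (creal_comp (g := fun r => a * r)) => // x _.
by apply: continuity_pt_scal; apply: derivable_continuous_pt; apply: derivable_pt_id.
Qed.

Lemma eq_creal h k : (forall x, A x -> h x = k x) -> creal h -> creal k.
Proof.
move=> hk ch x Ax e /(ch x Ax)[d d0 dP]; exists d => // x' Ax' n.
by rewrite -!hk //; apply: dP.
Qed.

Lemma creal_sub h k : creal h -> creal k -> creal (fun x => h x - k x).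
Proof.
move=> ch ck; apply: (eq_creal (h := fun x => h x + -1 * k x)) => [x _|]; first by ring.
by apply: creal_add => //; apply: creal_scal.
Qed.

(* Polarization reduces products to the continuity of squaring. *)
Lemma creal_mul h k : creal h -> creal k -> creal (fun x => h x * k x).
Proof.
move=> ch ck.
have sq j : creal j -> creal (fun x => Rsqr (j x)).
  by move=> cj; apply: creal_comp => // x _; apply: derivable_continuous_pt; apply: derivable_pt_Rsqr.
apply: (eq_creal (h := fun x => / 4 * (Rsqr (h x + k x) - Rsqr (h x - k x)))).
  by move=> x _; rewrite /Rsqr; field.
by apply/creal_scal/creal_sub; apply: sq; [apply: creal_add|apply: creal_sub].
Qed.

Lemma creal_inv h : creal h -> (forall x, A x -> h x <> 0) -> creal (fun x => / h x).
Proof.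
move=> ch h0; apply: (creal_comp (g := fun r => / r)) => // x Ax.
apply: (continuity_pt_inv id); last exact: h0.
by apply: derivable_continuous_pt; apply: derivable_pt_id.
Qed.

Lemma creal_div h k : creal h -> creal k -> (forall x, A x -> k x <> 0) ->
  creal (fun x => h x / k x).
Proof. by move=> ch ck k0; apply: creal_mul => //; apply: creal_inv. Qed.

Lemma creal_min h k : creal h -> creal k -> creal (fun x => Rmin (h x) (k x)).
Proof.
move=> ch ck x Ax e e0.
have [d d0 dP] := ch x Ax e e0; have [d' d'0 d'P] := ck x Ax e e0.
exists (Rmin d d') => [|x' Ax' /near_min[n n']]; first exact: Rmin_glb_lt.
have := dP x' Ax' n; have := d'P x' Ax' n'.
by rewrite /Rmin; do 2 case: Rle_dec => ?; split_Rabs; lra.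
Qed.

Lemma creal_big (op : R -> R -> R) (a : R) I (r : seq I) (P : pred I) (h : I -> pt p -> R) :
  (forall h k, creal h -> creal k -> creal (fun x => op (h x) (k x))) ->
  (forall i, creal (h i)) -> creal (fun x => \big[op/a]_(i <- r | P i) h i x).
Proof.
move=> cop ch; elim: r => [|i r IHr].
  by apply: (eq_creal (h := fun=> a)) => [x _|]; [rewrite big_nil|apply: creal_const].
have [Pi|Pi] := boolP (P i).
  apply: (eq_creal (h := fun x => op (h i x) (\big[op/a]_(i <- r | P i) h i x))) => [x _|].
    by rewrite big_cons Pi.
  exact: cop.
by apply: eq_creal IHr => x _; rewrite big_cons (negPf Pi).
Qed.

Lemma creal_rsum n (h : 'I_n -> pt p -> R) :
  (forall i, creal (h i)) -> creal (fun x => rsum (fun i => h i x)).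
Proof. by move=> ch; apply: creal_big => //; apply: creal_add. Qed.

Lemma creal_continuous_on q (f : pt p -> pt q) :
  (forall i, creal (fun x => f x i)) -> continuous_on A f.
Proof.
move=> cf; apply/continuous_onP => x Ax e e0.
have [||d d0 dP] := @uniform_radius 'I_q (enum 'I_q) (fun i d =>
  forall x', A x' -> near d x x' -> Rabs (f x i - f x' i) < e).
- move=> i r r' rr' rP x' Ax' xx'; apply: rP => // j.
  by have := xx' j; lra.
- by move=> i _; have [d d0 dP] := cf i x Ax e e0; exists d.
by exists d => // x' Ax' xx' i; apply: dP; rewrite ?mem_enum.
Qed.

End ContinuityCalculus.

Lemma continuous_on_comp p q r (A : pt p -> Prop) (B : pt q -> Prop)
    (f : pt p -> pt q) (g : pt q -> pt r) :
  continuous_on A f -> (forall x, A x -> B (f x)) -> continuous_on B g ->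
  continuous_on A (fun x => g (f x)).
Proof.
move=> /continuous_onP cf fAB /continuous_onP cg; apply/continuous_onP => x Ax e e0.
have [d d0 dP] := cg (f x) (fAB x Ax) e e0.
have [s s0 sP] := cf x Ax d d0.
by exists s => // x' Ax' xx'; apply: dP; [exact: fAB|exact: sP].
Qed.

Lemma continuous_on_sub p q (A B : pt p -> Prop) (f : pt p -> pt q) :
  (forall x, A x -> B x) -> continuous_on B f -> continuous_on A f.
Proof.
move=> AB cf x Ax e e0; have [d d0 dP] := cf x (AB x Ax) e e0.
by exists d => // x' /AB; apply: dP.
Qed.

Lemma closed_level p (h : pt p -> R) (a : R) :
  creal (fun=> True) h -> pt_closed (fun x => h x = a).
Proof.
move=> ch y yP; apply: cond_eq => e e0.
have [d d0 dP] := ch y I e e0; have [x <- xy] := yP d d0.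
by apply: dP => // i; rewrite Rabs_minus_sym.
Qed.

Lemma closed_le p (h : pt p -> R) (a : R) :
  creal (fun=> True) h -> pt_closed (fun x => h x <= a).
Proof.
move=> ch y yP; apply: Rnot_lt_le => lt.
have [|d d0 dP] := ch y I (h y - a); first by lra.
have [x xa xy] := yP d d0.
have := dP x I; have yx : near d y x by move=> i; rewrite Rabs_minus_sym.
by move=> /(_ yx); split_Rabs; lra.
Qed.

Section RealizationCompact.
Variables (m : nat) (K : {set {set 'I_m}}).
Hypothesis complexK : simplicial_complex K.

Lemma realization_bounded : pt_bounded (realization K).
Proof.
exists 1 => x i /realizationE[x0 x1 _].
by rewrite Rabs_pos_eq // -x1; apply: rsum_ge_term.
Qed.

(** Supports can only shrink in the limit: coordinates positive at [y] stay positive at nearby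
    points, so [supp y] lies in a face of [K] and is itself a face. *)
Lemma realization_closed : pt_closed (realization K).
Proof.
move=> y yP; have y0 i : 0 <= y i.
  have ci : creal (fun=> True) (fun x : pt m => -1 * x i).
    exact/creal_scal/creal_coord.
  suff : -1 * y i <= 0 by lra.
  apply: (closed_le ci) => e /yP[x /realizationE[x0 _ _] xy]; exists x => //.
  by have := x0 i; lra.
apply/realizationE; split=> //.
  have cs : creal (fun=> True) (fun x : pt m => rsum x).
    by apply: creal_rsum => i; apply: creal_coord.
  by apply: (closed_level cs) => e /yP[x /realizationE[_ x1 _] xy]; exists x.
have [||r r0 rP] := @uniform_radius 'I_m (enum (supp y)) (fun i r => r <= y i).
- by move=> i r r' ? ?; lra.
- by move=> i; rewrite mem_enum => /in_supp yi; exists (y i) => //; lra.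
have [x /realizationE[_ _ xK] xy] := yP r r0.
case: complexK => _ cK; apply: cK xK _; apply/subsetP => i iy; apply/in_supp.
have := rP i; rewrite mem_enum => /(_ iy).
by have := xy i; split_Rabs; lra.
Qed.

Lemma realization_heine q (f : pt m -> pt q) :
  continuous_on (realization K) f -> unif_continuous_on (realization K) f.
Proof. exact: heine realization_closed realization_bounded. Qed.

End RealizationCompact.

(** * Stereographic projection and radial retraction *)

Definition dotp n (x y : 'I_n -> R) : R := rsum (fun i => x i * y i).

Section DotProduct.
Variable n : nat.
Implicit Types (x y z p u : 'I_n -> R).

Lemma eq_rsum x y : (forall i, x i = y i) -> rsum x = rsum y.
Proof. by move=> xy; congr rsum; apply/funext. Qed.

Lemma dotpC x y : dotp x y = dotp y x.
Proof. by apply: eq_rsum => i; rewrite Rmult_comm. Qed.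

Lemma dotp_lin (a b : R) x y z :
  dotp (fun i => a * x i + b * y i) z = a * dotp x z + b * dotp y z.
Proof.
rewrite /dotp -!rsumE -rsumD; apply: eq_rsum => i; ring.
Qed.

Lemma dotp_ge0 x : 0 <= dotp x x.
Proof. by apply: rsum_ge0 => i; apply: Rle_0_sqr. Qed.

Lemma dotp_eq0 x : dotp x x = 0 -> forall i, x i = 0.
Proof.
move=> x0 i; apply: Rsqr_0_uniq; apply: Rle_antisym; last exact: Rle_0_sqr.
by rewrite -x0; apply: (@rsum_ge_term n (fun i => x i * x i)) => j; apply: Rle_0_sqr.
Qed.

Lemma dotp_lin2 (a b : R) x y :
  dotp (fun i => a * x i + b * y i) (fun i => a * x i + b * y i) =
  a * a * dotp x x + 2 * a * b * dotp x y + b * b * dotp y y.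
Proof.
set w := fun i => _.
have wx : dotp x w = a * dotp x x + b * dotp x y.
  by rewrite dotpC dotp_lin (dotpC y x).
have wy : dotp y w = a * dotp x y + b * dotp y y by rewrite dotpC dotp_lin.
by rewrite {1}/w dotp_lin wx wy; ring.
Qed.

Lemma creal_dotp q (A : pt q -> Prop) (f g : 'I_n -> pt q -> R) :
  (forall i, creal A (f i)) -> (forall i, creal A (g i)) ->
  creal A (fun v : pt q => dotp (fun i => f i v) (fun i => g i v)).
Proof. by move=> cf cg; apply: creal_rsum => i; apply: creal_mul. Qed.

(** For unit vectors the squared norm of [y - p] is 2 - 2 <y, p>. *)
Lemma dotp_lt1 y p : dotp y y = 1 -> dotp p p = 1 -> y <> p -> dotp y p < 1.
Proof.
move=> y1 p1 yp; apply: Rnot_le_lt => le1; apply: yp; apply/funext => i.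
pose w := fun i => 1 * y i + -1 * p i.
have w0 : dotp w w = 0.
  by apply: Rle_antisym (dotp_ge0 w); rewrite dotp_lin2 y1 p1; lra.
by have := dotp_eq0 w0 i; rewrite /w; lra.
Qed.

(* Stereographic projection from the pole [p], onto the hyperplane orthogonal
   to [p]; [stereo_inv] is its inverse, and is defined everywhere. *)
Definition stereo p y : 'I_n -> R :=
  fun i => / (1 - dotp y p) * y i + - (dotp y p / (1 - dotp y p)) * p i.

Definition stereo_inv p u : 'I_n -> R :=
  fun i => 2 / (dotp u u + 1) * u i + (dotp u u - 1) / (dotp u u + 1) * p i.

Variable p : 'I_n -> R.
Hypothesis p1 : dotp p p = 1.

Lemma stereo_orth y : dotp y p <> 1 -> dotp (stereo p y) p = 0.
Proof. by move=> yp; rewrite dotp_lin p1; field; lra. Qed.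

Lemma stereo_sq y : dotp y y = 1 -> dotp y p <> 1 ->
  dotp (stereo p y) (stereo p y) = (1 + dotp y p) / (1 - dotp y p).
Proof. by move=> y1 yp; rewrite dotp_lin2 y1 p1; field; lra. Qed.

Lemma stereoK y : dotp y y = 1 -> dotp y p <> 1 -> stereo_inv p (stereo p y) = y.
Proof.
move=> y1 yp; apply/funext => i; rewrite /stereo_inv stereo_sq // /stereo.
by field; lra.
Qed.

Lemma stereo_inv_sphere u : dotp u p = 0 -> dotp (stereo_inv p u) (stereo_inv p u) = 1.
Proof. by move=> up; rewrite dotp_lin2 up p1; field; have := dotp_ge0 u; lra. Qed.

Lemma stereo_inv_neq u : dotp u p = 0 -> stereo_inv p u <> p.
Proof.
move=> up /(congr1 (fun x => dotp x p)); rewrite dotp_lin up p1.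
have u0 := dotp_ge0 u => h.
have : (dotp u u - 1) = dotp u u + 1.
  have -> : dotp u u + 1 = (dotp u u + 1) * (2 / (dotp u u + 1) * 0 + (dotp u u - 1) / (dotp u u + 1) * 1).
    by rewrite h Rmult_1_r.
  by field; lra.
by lra.
Qed.

Lemma stereo_continuous : continuous_on (fun y => dotp y y = 1 /\ y <> p) (stereo p).
Proof.
have cd : creal (fun y => dotp y y = 1 /\ y <> p) (fun y => dotp y p).
  by apply: creal_dotp => i; [apply: creal_coord|apply: creal_const].
have c1 : creal (fun y => dotp y y = 1 /\ y <> p) (fun y => 1 - dotp y p).
  by apply: creal_sub => //; apply: creal_const.
have n0 y : dotp y y = 1 /\ y <> p -> 1 - dotp y p <> 0.
  by move=> [y1 yp]; have := dotp_lt1 y1 p1 yp; lra.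
apply: creal_continuous_on => i; apply: creal_add; apply: creal_mul.
- exact: creal_inv.
- exact: creal_coord.
- apply: (eq_creal (h := fun y => -1 * (dotp y p / (1 - dotp y p)))) => [y _|]; first by ring.
  by apply/creal_scal/creal_div.
- exact: creal_const.
Qed.

Lemma stereo_inv_continuous A : continuous_on A (stereo_inv p).
Proof.
have cd : creal A (fun u => dotp u u).
  by apply: creal_dotp => i; apply: creal_coord.
have n0 u : A u -> dotp u u + 1 <> 0 by move=> _; have := dotp_ge0 u; lra.
have c1 : creal A (fun u => dotp u u + 1) by apply: creal_add => //; apply: creal_const.
apply: creal_continuous_on => i; apply: creal_add; apply: creal_mul.
- by apply: creal_div => //; apply: creal_const.
- exact: creal_coord.
- by apply: creal_div => //; apply: creal_sub => //; apply: creal_const.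
- exact: creal_const.
Qed.

End DotProduct.

Section RadialRetraction.
Variables (m : nat) (D : {set {set 'I_m}}) (s : {set 'I_m}).
Hypotheses (complexD : simplicial_complex D) (sD : s \in D) (s_neq0 : s != set0).
Hypothesis s_max : forall t, t \in D -> s \subset t -> t = s.
Local Notation K := (D :\ s).

Let n := INR #|s|.

Let n_gt0 : 0 < n.
Proof. by apply/lt_0_INR/ltP; rewrite card_gt0. Qed.

Lemma rsum_mem (t : {set 'I_m}) : rsum (fun i => if i \in t then 1 else 0) = INR #|t|.
Proof.
rewrite /rsum -big_mkcond /= big_const.
by elim: #|t| => // k IHk; rewrite iterS IHk S_INR Rplus_comm.
Qed.

Definition barycenter : pt m := fun i => if i \in s then / n else 0.

(** The default 1 is neutral on the realization, where coordinates are at most 1 and [s] is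
    nonempty. *)
Definition min_coord (x : pt m) : R := \big[Rmin/1]_(i in s) x i.

(** Projection away from the barycenter b: with mu the least coordinate of x on [s], one has x = n
    mu b + (1 - n mu) radial x, and the image has a zero coordinate on [s]. *)
Definition radial (x : pt m) : pt m := fun i =>
  (x i - (if i \in s then min_coord x else 0)) / (1 - n * min_coord x).

Lemma barycenter_realization : realization D barycenter.
Proof.
have n0 := Rinv_0_lt_compat _ n_gt0.
apply/realizationE; split.
- by move=> i; rewrite /barycenter; case: ifP => _; lra.
- transitivity (/ n * rsum (fun i => if i \in s then 1 else 0)); last first.
    by rewrite rsum_mem Rinv_l // -/n; lra.
  rewrite -rsumE; apply: eq_rsum => i.
  by rewrite /barycenter; case: ifP => _; ring.
- suff -> : supp barycenter = s by [].
  apply/setP => i; apply/idP/idP => [/in_supp|iS]; last first.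
    by apply/in_supp; rewrite /barycenter iS.
  by rewrite /barycenter; case: ifP => // _ /Rlt_irrefl.
Qed.

Lemma min_coord_le x i : i \in s -> min_coord x <= x i.
Proof.
move=> iS; rewrite /min_coord; have := mem_index_enum i.
elim: (index_enum _) => // j l IHl; rewrite inE big_cons => /orP[/eqP<-|/IHl h].
  by rewrite iS; apply: Rmin_l.
by case: ifP => // _; apply: Rle_trans h; apply: Rmin_r.
Qed.

Lemma min_coord_ge0 x : (forall i, 0 <= x i) -> 0 <= min_coord x.
Proof.
move=> x0; rewrite /min_coord; elim/big_rec: _ => [|i y _ y0]; first by lra.
exact: Rmin_glb.
Qed.

Lemma min_coord_attained x : (forall i, 0 <= x i) -> rsum x = 1 ->
  exists2 i, i \in s & min_coord x = x i.
Proof.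
move=> x0 x1; apply: contrapT => nx.
have [i0 i0s] := set0Pn _ s_neq0.
have [|e] : (exists2 i, i \in s & min_coord x = x i) \/ min_coord x = 1; last first.
- apply: nx; exists i0 => //; apply: Rle_antisym; first exact: min_coord_le.
  by rewrite e -x1; apply: rsum_ge_term.
- by move=> h; apply: nx.
rewrite /min_coord; elim/big_rec: _ => [|i y iS IH]; first by right.
have [h|h] := Rle_lt_dec (x i) y.
  by left; exists i => //; rewrite Rmin_left.
by rewrite Rmin_right //; lra.
Qed.

(** Subtracting the least coordinate on [s] leaves nonnegative coordinates of sum 1 - n mu. If that
    sum is not positive, they all vanish and [x] is the barycenter. *)
Lemma radial_denominator x : realization D x -> x <> barycenter -> n * min_coord x < 1.
Proof.
move=> /realizationE[x0 x1 _] xb; apply: Rnot_le_lt => le1; apply: xb.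
set mu := min_coord x in le1.
pose w i := x i + - mu * (if i \in s then 1 else 0).
have w0 i : 0 <= w i.
  rewrite /w; case: ifP => [/(min_coord_le x)|_]; rewrite -/mu; first by lra.
  by have := x0 i; lra.
have ws : rsum w = 1 - n * mu by rewrite rsumD rsumE rsum_mem x1 /n; ring.
have wi i : w i = 0.
  by have := rsum_ge_term i w0; have := rsum_ge0 w0; have := w0 i; lra.
have mun : mu = / n.
  have := rsum_ge0 w0; rewrite ws => h; have e : n * mu = 1 by lra.
  by apply: (Rmult_eq_reg_l n); [rewrite e Rinv_r //; lra|lra].
apply/funext => i; have := wi i; rewrite /w /barycenter -mun.
by case: ifP => _; lra.
Qed.

Lemma min_coord_eq0 x : realization K x -> min_coord x = 0.
Proof.
move=> /realizationE[x0 x1 /setD1P[xs xD]].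
have [i iS xi] : exists2 i, i \in s & i \notin supp x.
  by apply/subsetPn; apply: contra xs => sx; apply/eqP; apply: s_max.
apply: Rle_antisym; last exact: min_coord_ge0.
apply: Rle_trans (min_coord_le x iS) _; apply: Rnot_lt_le => x_gt0.
by move/negP: xi; apply; apply/in_supp.
Qed.

Lemma radial_id x : realization K x -> radial x = x.
Proof.
move=> xK; apply/funext => i; rewrite /radial min_coord_eq0 //.
by case: ifP => _; field.
Qed.

Lemma radial_realization x : realization D x -> x <> barycenter -> realization K (radial x).
Proof.
move=> xD xb; have den := radial_denominator xD xb.
have /realizationE[x0 x1 xsD] := xD.
have [i0 i0s mu0] := min_coord_attained x0 x1.
have r0 i : 0 <= radial x i.
  apply: Rdiv_le_0_compat; last by lra.
  by case: ifP => [/(min_coord_le x)|_]; [|have := x0 i]; lra.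
have suppr : supp (radial x) \subset supp x.
  apply/subsetP => i /in_supp ri; apply/in_supp; have [//|xi] := Rlt_le_dec 0 (x i).
  suff : radial x i <= 0 by lra.
  rewrite /radial; have xi0 : x i = 0 by have := x0 i; lra.
  have mu_ge0 := min_coord_ge0 x0.
  have : 0 < / (1 - n * min_coord x) by apply: Rinv_0_lt_compat; lra.
  by rewrite xi0 /Rdiv; case: ifP => _; nra.
apply/realizationE; split=> //.
  transitivity (/ (1 - n * min_coord x) * rsum (fun i => x i + - min_coord x *
      (if i \in s then 1 else 0))).
    rewrite -rsumE; apply: eq_rsum => i; rewrite /radial.
    by case: ifP => _; field; lra.
  by rewrite rsumD rsumE rsum_mem x1 -/n; field; lra.
apply/setD1P; split; last by case: complexD => _ cD; apply: cD suppr.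
apply/eqP => rs; have : i0 \in supp (radial x) by rewrite rs.
move=> /in_supp; rewrite /radial i0s -mu0 Rminus_diag /Rdiv Rmult_0_l.
exact: Rlt_irrefl.
Qed.

Lemma radial_continuous :
  continuous_on (fun x => realization D x /\ x <> barycenter) radial.
Proof.
set A := fun x => _.
have cmu : creal A min_coord.
  by apply: creal_big => [h k|i]; [apply: creal_min|apply: creal_coord].
apply: creal_continuous_on => i; apply: creal_div.
- apply: creal_sub; first exact: creal_coord.
  by case: (i \in s) => //; apply: creal_const.
- by apply: creal_sub; [apply: creal_const|apply: creal_scal].
- by move=> x [xD xb]; have := radial_denominator xD xb; lra.
Qed.

End RadialRetraction.

(** * Triangulated spheres *)

Lemma complement_of_facet_acyclic d m (D : {set {set 'I_m}}) (s : {set 'I_m}) k :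
  simplicial_sphere D d -> s \in D -> s != set0 ->
  (forall t, t \in D -> s \subset t -> t = s) ->
  simplicial_complex (D :\ s) -> sacyclic (D :\ s) k.
Proof.
move=> [complexD [f [g [fS gD gf fg [cf cg]]]]] sD s0 s_max complexK.
have [v0 _] := set0Pn _ s0.
pose b := barycenter s; have bD : realization D b by apply: barycenter_realization.
pose p := f b; have p1 : dotp p p = 1 by apply: fS.
have KD x : realization (D :\ s) x -> realization D x.
  by move=> /realizationE[x0 x1 /setD1P[_ xD]]; apply/realizationE.
have Kb x : realization (D :\ s) x -> x <> b.
  move=> xK xb; have [i0 i0s] := set0Pn _ s0.
  have := min_coord_eq0 s_max xK; have [i iS ->] : exists2 i, i \in s & min_coord s x = x i.
    by have /realizationE[x0 x1 _] := xK; apply: min_coord_attained.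
  rewrite xb /b /barycenter iS; apply/Rgt_not_eq/Rinv_0_lt_compat/lt_0_INR/ltP.
  by rewrite card_gt0.
have fp x : realization D x -> x <> b -> f x <> p.
  by move=> xD xb /(congr1 g); rewrite /p !gf.
have lt1 x : realization D x -> x <> b -> dotp (f x) p <> 1.
  by move=> xD xb; have := dotp_lt1 (fS x xD) p1 (fp x xD xb); lra.
pose F x := stereo p (f x).
have cF : continuous_on (realization (D :\ s)) F.
  apply: (continuous_on_comp (B := fun y => dotp y y = 1 /\ y <> p)).
  - exact: continuous_on_sub KD cf.
  - by move=> x xK; split; [apply/fS/KD|apply: fp; [apply: KD|apply: Kb]].
  - exact: stereo_continuous.
have clK := realization_closed complexK.
have bK := @realization_bounded m (D :\ s).
have [M0 FM0] := continuous_on_bounded clK bK cF.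
pose M := Rabs M0; have M_ge0 : 0 <= M by apply: Rabs_pos.
have FM x i : realization (D :\ s) x -> Rabs (F x i) <= M.
  by move=> /FM0 h; apply: Rle_trans (h i) (RRle_abs _).
(* Cutting the hyperplane by a cube makes [X] compact, so that [G] is uniformly continuous. The size
   [M] comes from the compactness of the realization of [D :\ s], and convexity keeps [X]
   star-shaped about 0. *)
pose X (u : pt d.+1) := dotp u p = 0 /\ forall i, Rabs (u i) <= M.
have bX : pt_bounded X by exists M => u i [_].
have clX : pt_closed X.
  have cdot : creal (fun=> True) (fun u : pt d.+1 => dotp u p).
    by apply: creal_dotp => i; [apply: creal_coord|apply: creal_const].
  have cpos i : creal (fun=> True) (fun u : pt d.+1 => u i) by apply: creal_coord.
  have cneg i : creal (fun=> True) (fun u : pt d.+1 => -1 * u i) by apply: creal_scal.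
  move=> u uP; split.
    by apply: (closed_level cdot) => e /uP[u' [u'p _] uu']; exists u'.
  move=> i; apply: Rabs_le; split.
    suff : -1 * u i <= M by lra.
    apply: (closed_le (cneg i)) => e /uP[u' [_ /(_ i) u'M] uu']; exists u' => //.
    by move: u'M; split_Rabs; lra.
  apply: (closed_le (cpos i)) => e /uP[u' [_ /(_ i) u'M] uu']; exists u' => //.
  by move: u'M; split_Rabs; lra.
have starX : star_shaped X (fun=> 0).
  split=> [|u t [up uM] t01].
    split=> [|i]; last by rewrite Rabs_R0.
    by rewrite /dotp rsumE; ring.
  split=> [|i].
    by rewrite dotp_lin up /dotp rsumE; ring.
  rewrite /homothety; have := uM i; split_Rabs; nra.
pose G u := radial s (g (stereo_inv p u)).
have siS u : X u -> dotp (stereo_inv p u) (stereo_inv p u) = 1.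
  by move=> [up _]; apply: stereo_inv_sphere.
have gsib u : X u -> g (stereo_inv p u) <> b.
  move=> Xu /(congr1 f); rewrite fg; last exact: siS.
  by case: Xu => up _; apply: stereo_inv_neq.
have cG : continuous_on X G.
  apply: (continuous_on_comp (f := fun u => g (stereo_inv p u))
    (B := fun x => realization D x /\ x <> b)); last exact: radial_continuous.
    apply: (continuous_on_comp (B := @sphere d)) => //.
    exact: stereo_inv_continuous.
  by move=> u Xu; split; [apply/gD/siS|apply: gsib].
apply: (@sacyclic_of_retract m v0 (D :\ s) complexK d.+1 X k F G).
- by move=> x xK; split; [apply: stereo_orth => //; apply: lt1; [apply: KD|apply: Kb]|move=> i; apply: FM].
- by move=> u Xu; apply: radial_realization => //; [apply/gD/siS|apply: gsib].
- move=> x xK; rewrite /G /F stereoK //; last by apply: lt1; [apply: KD|apply: Kb].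
    by rewrite gf; [exact: radial_id s_max _ xK|exact: KD].
  by apply/fS/KD.
- exact: heine.
- exact: heine.
- exact: star_fine_acyclic starX.
Qed.

(** * The boundary of a simplex as a model of the sphere *)

Section SimplexBoundary.
Variable d : nat.

Definition simplex_boundary : {set {set 'I_d.+2}} := [set t | t != setT].

Lemma simplex_boundary_complex : simplicial_complex simplex_boundary.
Proof.
split=> [|s t]; rewrite !inE.
  by apply/eqP => /setP/(_ ord0); rewrite !inE.
by move=> sT ts; apply: contraNneq sT => tT; rewrite tT subTset in ts.
Qed.

(** Coning at vertex 0 leaves the complex only by producing the full set, which needs [k = d.+1].
    For larger [k] there are no nonzero chains. *)
Lemma simplex_boundary_acyclic k : k != d.+1 -> sacyclic simplex_boundary k.
Proof.
move=> kd c Lc bc; have [kd'|dk] := ltnP k d.+1.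
  exists (sext ord0 c); last first.
    by have := sbd_ext ord0 c; rewrite bc raddf0 addr0.
  apply: chains_slin Lc => s sL sk; case: ifPn => [_|s0]; first exact: chains0.
  have uk : #|ord0 |: s| = k.+1 by rewrite cardsU1 s0 sk.
  rewrite -uk; apply/chains_mulz/chains1; rewrite inE.
  by apply: contraTneq kd' => uT; move: uk; rewrite uT cardsT card_ord => -[<-]; rewrite ltnn.
have c0 : c = 0%ring.
  apply/ffunP => s; rewrite ffunE; apply/eqP; apply: contraT => /Lc/andP[].
  rewrite inE => sT /eqP sk; case/negP: sT; rewrite eqEcard subsetT cardsT card_ord sk.
  by rewrite ltn_neqAle eq_sym kd dk.
by exists 0%ring; [apply: chains0|rewrite raddf0 c0].
Qed.

Definition extend0 (y : 'I_d.+1 -> R) : pt d.+2 :=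
  fun i => if unlift ord_max i is Some j then y j else 0.

(** The default 0 counts: it is the last coordinate of [extend0 y], so this is the minimum over all
    coordinates of the extended point. *)
Definition min0 (y : 'I_d.+1 -> R) : R := \big[Rmin/0]_j y j.

Definition shifted_sum (y : 'I_d.+1 -> R) : R := rsum (fun i => extend0 y i - min0 y).

(* Translating [(y, 0)] along the diagonal until its least coordinate vanishes
   and rescaling gives a homeomorphism of the sphere onto the boundary of the
   simplex, with inverse [boundary_to_sphere]. *)
Definition sphere_to_boundary (y : 'I_d.+1 -> R) : pt d.+2 :=
  fun i => (extend0 y i - min0 y) / shifted_sum y.

(** Differences with the last coordinate undo the translation along the diagonal; normalisation will
    undo the rescaling. *)
Definition edge_vector (x : pt d.+2) : 'I_d.+1 -> R :=
  fun j => x (fintype.lift ord_max j) - x ord_max.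

Definition boundary_to_sphere (x : pt d.+2) : 'I_d.+1 -> R :=
  fun j => edge_vector x j / sqrt (dotp (edge_vector x) (edge_vector x)).

Lemma min0_le y j : min0 y <= y j.
Proof.
rewrite /min0; have := mem_index_enum j.
elim: (index_enum _) => // i l IHl; rewrite inE big_cons => /orP[/eqP<-|/IHl h].
  exact: Rmin_l.
exact: Rle_trans (Rmin_r _ _) h.
Qed.

Lemma min0_le0 y : min0 y <= 0.
Proof.
rewrite /min0; elim/big_rec: _ => [|j r _ r0]; first exact: Rle_refl.
exact: Rle_trans (Rmin_r _ _) r0.
Qed.

Lemma min0_attained y : exists i, extend0 y i = min0 y.
Proof.
rewrite /min0; elim/big_rec: _ => [|j r _ [i ir]].
  by exists ord_max; rewrite /extend0 unlift_none.
have [h|h] := Rle_lt_dec (y j) r.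
  by exists (fintype.lift ord_max j); rewrite /extend0 liftK Rmin_left.
by exists i; rewrite Rmin_right //; lra.
Qed.

Lemma extend0_ge y i : min0 y <= extend0 y i.
Proof. by rewrite /extend0; case: unlift => [j|]; [apply: min0_le|apply: min0_le0]. Qed.

Lemma shifted_sum_gt0 y : dotp y y = 1 -> 0 < shifted_sum y.
Proof.
move=> y1; apply: Rnot_le_lt => S0.
have term i : extend0 y i - min0 y = 0.
  have pos j : 0 <= extend0 y j - min0 y by have := extend0_ge y j; lra.
  by have := rsum_ge_term i pos; rewrite -/(shifted_sum y); have := pos i; lra.
have m0 : min0 y = 0.
  by have := term ord_max; rewrite /extend0 unlift_none; lra.
have : dotp y y = 0.
  rewrite /dotp (eq_rsum (y := fun j => 0 * y j)) ?rsumE; first by ring.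
  by move=> j; have := term (fintype.lift ord_max j); rewrite /extend0 liftK m0 => h; have -> : y j = 0 by lra.
by rewrite y1; lra.
Qed.

Lemma sphere_to_boundary_realization y :
  dotp y y = 1 -> realization simplex_boundary (sphere_to_boundary y).
Proof.
move=> y1; have S0 := shifted_sum_gt0 y1; have Si := Rinv_0_lt_compat _ S0.
apply/realizationE; split.
- move=> i; apply: Rmult_le_pos; last by lra.
  by have := extend0_ge y i; lra.
- transitivity (/ shifted_sum y * shifted_sum y); last by field; lra.
  by rewrite /shifted_sum -rsumE; apply: eq_rsum => i; rewrite Rmult_comm.
rewrite inE; apply/eqP => /setP sT; have [i im] := min0_attained y.
have /in_supp : i \in supp (sphere_to_boundary y) by rewrite sT inE.
by rewrite /sphere_to_boundary im Rminus_diag /Rdiv Rmult_0_l => /Rlt_irrefl.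
Qed.

(** If it vanished, all coordinates of [x] would be equal, hence positive, and the support would be
    the full set. *)
Lemma edge_vector_neq0 x : realization simplex_boundary x ->
  0 < dotp (edge_vector x) (edge_vector x).
Proof.
move=> /realizationE[x0 x1 xL]; have [//|h] := Rle_lt_or_eq_dec _ _ (dotp_ge0 (edge_vector x)).
have w0 := dotp_eq0 (esym h).
have xc i : x i = x ord_max.
  by case: (unliftP ord_max i) => [j ->|-> //]; have := w0 j; rewrite /edge_vector; lra.
have xpos : 0 < x ord_max.
  apply: Rnot_le_lt => le0; have := x1.
  have -> : rsum x = rsum (fun _ : 'I_d.+2 => 0).
    by apply: eq_rsum => i; rewrite xc; have := x0 ord_max; lra.
  by rewrite rsum_const; lra.
move: xL; rewrite inE => /eqP; case; apply/setP => i; rewrite in_setT.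
by apply/in_supp; rewrite xc.
Qed.

Lemma boundary_to_sphere_sphere x : realization simplex_boundary x ->
  dotp (boundary_to_sphere x) (boundary_to_sphere x) = 1.
Proof.
move=> /edge_vector_neq0 w0; set w := edge_vector x in w0 *.
have sq := sqrt_sqrt _ (Rlt_le _ _ w0); have s0 := sqrt_lt_R0 _ w0.
transitivity (/ (sqrt (dotp w w) * sqrt (dotp w w)) * dotp w w).
  rewrite /dotp -rsumE; apply: eq_rsum => j; rewrite -/(dotp w w) /boundary_to_sphere -/w.
  by field; lra.
by rewrite sq; field; lra.
Qed.

Lemma sphere_to_boundaryK y : dotp y y = 1 ->
  boundary_to_sphere (sphere_to_boundary y) = y.
Proof.
move=> y1; have S0 := shifted_sum_gt0 y1.
have wE : edge_vector (sphere_to_boundary y) = fun j => / shifted_sum y * y j.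
  apply/funext => j; rewrite /edge_vector /sphere_to_boundary /extend0 liftK unlift_none.
  by field; lra.
apply/funext => j; rewrite /boundary_to_sphere wE.
have -> : dotp (fun j => / shifted_sum y * y j) (fun j => / shifted_sum y * y j) =
    Rsqr (/ shifted_sum y).
  transitivity (Rsqr (/ shifted_sum y) * dotp y y); last by rewrite y1; ring.
  by rewrite /dotp -rsumE; apply: eq_rsum => i; rewrite /Rsqr; ring.
rewrite sqrt_Rsqr; first by field; lra.
by apply/Rlt_le/Rinv_0_lt_compat.
Qed.

Lemma sphere_to_boundary_continuous : continuous_on (@sphere d) sphere_to_boundary.
Proof.
have cmin : creal (@sphere d) min0.
  by apply: creal_big => [h k|j]; [apply: creal_min|apply: creal_coord].
have cnum i : creal (@sphere d) (fun y => extend0 y i - min0 y).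
  apply: creal_sub => //; rewrite /extend0; case: unlift => [j|]; first exact: creal_coord.
  exact: creal_const.
apply: creal_continuous_on => i; apply: creal_div => //; first exact: creal_rsum.
by move=> y /shifted_sum_gt0; lra.
Qed.

Lemma boundary_to_sphere_continuous :
  continuous_on (realization simplex_boundary) boundary_to_sphere.
Proof.
have cw j : creal (realization simplex_boundary) (fun x => edge_vector x j).
  by apply: creal_sub; apply: creal_coord.
apply: creal_continuous_on => j; apply: creal_div => //.
  apply: creal_comp => [|x _]; first exact: creal_dotp.
  by apply: continuity_pt_sqrt; apply: dotp_ge0.
by move=> x /edge_vector_neq0/sqrt_lt_R0; lra.
Qed.

End SimplexBoundary.

(** Both realizations are compact, so the comparison maps through the sphere are uniformly
    continuous, as the transfer of scales requires. *)
Lemma sphere_acyclic d m (D : {set {set 'I_m}}) (v0 : 'I_m) k :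
  simplicial_sphere D d -> k != d.+1 -> sacyclic D k.
Proof.
move=> [complexD [f [g [fS gD gf fg [cf cg]]]]] kd.
have complexL := @simplex_boundary_complex d.
apply: (@sacyclic_of_retract m v0 D complexD d.+2 (realization (simplex_boundary d)) k
  (fun x => sphere_to_boundary (f x)) (fun y => g (boundary_to_sphere y))).
- by move=> x xD; apply/sphere_to_boundary_realization/fS.
- by move=> y yL; apply/gD/boundary_to_sphere_sphere.
- by move=> x xD; rewrite sphere_to_boundaryK ?gf //; apply: fS.
- apply: realization_heine => //.
  by apply: continuous_on_comp cf fS _; apply: sphere_to_boundary_continuous.
- apply: realization_heine => //.
  apply: continuous_on_comp (@boundary_to_sphere_continuous d) _ cg.
  exact: boundary_to_sphere_sphere.
- by apply: realization_fine_acyclic => //; [apply: ord0|apply: simplex_boundary_acyclic].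
Qed.

Theorem mainTheorem9 (d m : nat) (D : {set {set 'I_m}}) :
  (1 <= d)%N -> simplicial_sphere D d ->
  critical_group_iso_Zmod D d.-1 (num_faces D d).
Proof.
move=> d_gt0 sphereD; have [complexD [f [g [fS gD gf fg _]]]] := sphereD.
have [D0 _] := complexD.
pose s0 := [arg max_(s > set0 in D) #|s|]; have [s0D s0max] : s0 \in D /\
    forall s, s \in D -> (#|s| <= #|s0|)%N.
  by rewrite /s0; case: arg_maxnP.
have s0_neq0 : s0 != set0.
  (* Any point of the sphere would do: its image under [g] has nonempty support in [D], so the empty
     face is not the largest. *)
  pose y (i : 'I_d.+1) := if i == ord0 then 1 else 0.
  have /gD/realizationE[x0 x1 xD] : sphere y.
    transitivity (rsum y); last exact: rsum_indic.
    by apply: eq_rsum => i; rewrite /y; case: ifP => _; ring.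
  apply/eqP => s00; have := s0max _ xD; rewrite s00 cards0 leqn0 cards_eq0 => /eqP sx.
  have : 1 = 0.
    rewrite -x1 (eq_rsum (y := fun=> 0)) ?rsum_const; first by ring.
    move=> i; apply: Rle_antisym (x0 i); apply: Rnot_lt_le => /in_supp.
    by rewrite sx inE.
  by lra.
have [v0 _] := set0Pn _ s0_neq0.
have [e s0e] : exists e, #|s0| = e.+1.
  by exists #|s0|.-1; rewrite prednK // card_gt0.
have dimD s : s \in D -> (#|s| <= e.+1)%N by rewrite -s0e; apply: s0max.
have acyclicD s : s \in D -> #|s| = e.+1 -> forall k, sacyclic (D :\ s) k.
  move=> sD se k; apply: complement_of_facet_acyclic sphereD _ _ _ _ => //.
  - by rewrite -card_gt0 se.
  - move=> t tD st; apply/eqP; rewrite eq_sym eqEcard st se; exact: dimD.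
  - exact (complex_facetD1 complexD dimD se).
(* Otherwise the top cycle [z] would be the boundary of a chain on faces with [e.+2] vertices. There
   are none, yet [z s0 = 1]. *)
have ed : e = d.
  apply/eqP; apply: contraT => ned.
  have [_ [z [Dz z1 bz _ _]]] := facet_contraction_cycle complexD dimD acyclicD s0D s0e.
  have [|b Db bE] := @sphere_acyclic d m D v0 e.+1 sphereD _ z Dz bz.
    by rewrite eqSS.
  move: z1; rewrite -bE (chains_big dimD (ltnSn _) Db) raddf0 ffunE.
  by move/esym/eqP; rewrite oner_eq0.
rewrite {e}ed in s0e dimD acyclicD.
(* Faces of dimension [d.-1] have [d.-1.+1] vertices, which is [d] because [d] is positive. *)
rewrite /critical_group_iso_Zmod prednK //.
exact: critical_group_of_acyclic_facets s0D s0e.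
Qed.
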